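(* Let $Z$ be a real neutral strongly facially symmetric space, and let $e\in Z^*$ be a geometric tripotent such that $Z_1=\mathrm{co}(F_e\cup F_{-e})$. Let $\nabla=\{u\in\mathcal{GT}: u\le e\}\cup\{0\}$. If $\nabla$ is a Boolean algebra, then there exists a measure space $(\Omega,\Sigma,\mu)$ possessing the direct sum property such that $Z$ is isometrically isomorphic to the space $L_1(\Omega,\Sigma,\mu)$ of equivalence classes of integrable real-valued functions with norm $\|f\|=\int_\Omega |f|\,d\mu$.
   Context: Let $Z$ be a real normed space with closed unit ball $Z_1=\{x\in Z:\|x\|\le 1\}$ and dual $Z^*$; $\mathrm{co}$ denotes convex hull, and $\langle u,x\rangle=u(x)$ for $u\in Z^*$, $x\in Z$. Elements $x,y\in Z$ are orthogonal, $x\diamondsuit y$, if $\|x+y\|=\|x-y\|=\|x\|+\|y\|$; for $S\subset Z$, $S^\diamondsuit=\{x\in Z: x\diamondsuit y\ \forall y\in S\}$. A convex subset $F\subset Z_1$ is a face if $\lambda y+(1-\lambda)z\in F$ with $y,z\in Z_1$, $\lambda\in(0,1)$ implies $y,z\in F$. A face $F$ is norm exposed if $F=F_u:=\{x\in Z_1: u(x)=1\}$ for some $u\in Z^*$ with $\|u\|=1$. A projective unit is $u\in Z^*$ with $\|u\|=1$ and $u(y)=0$ for all $y\in F_u^\diamondsuit$. A norm exposed face $F_u$ is symmetric if there is a linear isometry $S_u$ of $Z$ onto $Z$ with $S_u^2=I$ whose fixed point set is exactly the topological direct sum $(\overline{\mathrm{sp}}F_u)\oplus F_u^\diamondsuit$,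 where $\overline{\mathrm{sp}}$ is the closed linear hull. $Z$ is weakly facially symmetric (WFS) if every norm exposed face of $Z_1$ is symmetric. $Z$ is strongly facially symmetric (SFS) if it is WFS and for every norm exposed face $F_u$ and every $g\in Z^*$ with $\|g\|=1$ and $F_u\subset F_g$ one has $S_u^*g=g$. For a symmetric face $F_u$, the geometric Peirce projectors are the contractive projectors $P_1(F_u)=(I-S_u)/2$, and $P_2(F_u)$, $P_0(F_u)$, the projectors of $Z$ onto $\overline{\mathrm{sp}}F_u$ and $F_u^\diamondsuit$ respectively, with $P_2(F_u)+P_0(F_u)=(I+S_u)/2$. A geometric tripotent is a projective unit $u\in Z^*$ such that $F_u$ is a symmetric face and $S_u^*u=u$; $\mathcal{GT}$ is the set of geometric tripotents, and $P_k(u)=P_k(F_u)$ for $u\in\mathcal{GT}$. A contractive projector $Q$ on $Z$ is neutral if, for each $x\in Z$, $\|Qx\|=\|x\|$ implies $Qx=x$; $Z$ is neutral if $P_2(u)$ is neutral for every $u\in\mathcal{GT}$. For $u,v\in\mathcal{GT}$, $u\le v$ means $F_u\subset F_v$; $0$ is taken as the least element of $\nabla$. It is known that $(\nabla,\le)$ is a complete orthomodular lattice with orthocomplementation $u^\perp=e-u$; ''$\nabla$ is a Boolean algebra'' refers to this structure. A measure space $(\Omega,\Sigma,\mu)$ has the direct sum property (standard notion) if $\Sigma$ contains a family $(A_i)_{i\in I}$ of pairwise disjoint sets of finite measure such that for every $A\in\Sigma$ of finite measure there are a countable $J\subset I$ and a $\mu$-null set $N$ with $A=\bigcup_{j\in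 J}(A\cap A_j)\cup N$.
   Formalization: Z is assumed complete (a Banach space); for merely normed Z the claim is false, since the finitely supported sequences with the ℓ_1-norm and e=(1,1,…) satisfy all hypotheses but are incomplete, while every L_1 is complete. *)

(* Defs.v *)
From HB Require Import structures.
From mathcomp Require Export all_boot all_order all_algebra.
From mathcomp Require Export all_classical all_reals all_analysis.

Set Implicit Arguments.
Unset Strict Implicit.
Unset Printing Implicit Defensive.

Export Order.TTheory GRing.Theory Num.Theory.
Export numFieldNormedType.Exports.

Local Open Scope classical_set_scope.
Local Open Scope ring_scope.

(* Elements of the dual Z^* are represented by functions Z -> R that are linear
   and continuous, so that equality in Z^* is equality of functions.

   The definitions are for an arbitrary real normed space Z. The representation
   theorem needs Z complete, because every L_1 is complete: the finitely
   supported sequences with the l_1-norm satisfy all its other hypotheses,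
   with e = (1, 1, ...). *)

Section Spaces.
Context {R : realType} {Z : normedModType R}.
Implicit Types (x y z : Z) (u v g e : Z -> R) (F A B S : set Z) (Q P : Z -> Z).

Definition unit_ball : set Z := [set x | `|x| <= 1].

Definition topological_dual : set (Z -> R) :=
  [set u : Z -> R | scalar u /\ continuous u].

Definition dual_norm u : R := sup [set `|u x| | x in unit_ball].

Definition dual_sphere : set (Z -> R) :=
  [set u : Z -> R | topological_dual u /\ dual_norm u = 1].

Definition convex_hull A : set Z :=
  smallest (fun C => convex_set (C : set (convex_lmodType Z))) A.

Definition linear_subspace A : Prop :=
  A 0 /\ forall (a : R) x y, A x -> A y -> A (a *: x + y).

Definition closed_span A : set Z := closure (smallest linear_subspace A).

Definition orthogonal x y : Prop :=
  `|x + y| = `|x| + `|y| /\ `|x - y| = `|x| + `|y|.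

Definition orthocomplement S : set Z :=
  [set x | forall y, S y -> orthogonal x y].

(* The last clause says that the projection of A + B onto A along B, hence also
   the one onto B, is continuous. *)
Definition topological_direct_sum A B : Prop :=
  [/\ linear_subspace A, linear_subspace B, A `&` B = [set 0] &
      exists C : R, forall x y, A x -> B y -> `|x| <= C * `|x + y|].

Definition face F : Prop :=
  [/\ F `<=` unit_ball, convex_set (F : set (convex_lmodType Z)) &
      forall y z (l : R), unit_ball y -> unit_ball z -> 0 < l < 1 ->
        F (l *: y + (1 - l) *: z) -> F y /\ F z].

Definition exposed u : set Z := [set x | unit_ball x /\ u x = 1].

Definition norm_exposed_face F : Prop :=
  face F /\ exists2 u, dual_sphere u & F = exposed u.

(* sym is onto because it is involutive. *)
Definition facial_symmetry F (sym : Z -> Z) : Prop :=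
  [/\ linear sym, (forall x, `|sym x| = `|x|), (forall x, sym (sym x) = x),
      topological_direct_sum (closed_span F) (orthocomplement F) &
      [set x | sym x = x] =
        [set x + y | x in closed_span F & y in orthocomplement F]].

Definition symmetric_face F : Prop := exists sym, facial_symmetry F sym.

Definition projector Q : Prop := linear Q /\ forall x, Q (Q x) = Q x.

Definition contractive_projector Q : Prop :=
  projector Q /\ forall x, `|Q x| <= `|x|.

(* P is the geometric Peirce projector P_2(F). It is unique when it exists: a
   symmetry of F is unique, and two projectors whose sum is a projector
   annihilate each other. *)
Definition peirce2 F P : Prop :=
  exists sym P0,
    [/\ facial_symmetry F sym,
        projector P /\ range P = closed_span F,
        projector P0 /\ range P0 = orthocomplement F &
        forall x, P x + P0 x = 2^-1 *: (x + sym x)].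

Definition neutral_projector Q : Prop :=
  contractive_projector Q /\ forall x, `|Q x| = `|x| -> Q x = x.

Definition projective_unit u : Prop :=
  dual_sphere u /\ forall y, orthocomplement (exposed u) y -> u y = 0.

Definition geometric_tripotent u : Prop :=
  projective_unit u /\
  exists2 sym, facial_symmetry (exposed u) sym & u \o sym = u.

Definition nabla e : set (Z -> R) :=
  [set u : Z -> R | geometric_tripotent u /\ exposed u `<=` exposed e]
  `|` [set cst 0].

(* The order of nabla e is u <= v iff exposed u `<=` exposed v. For the extra
   element 0 this is consistent, as exposed 0 is empty and the face of a
   geometric tripotent is not (otherwise its orthocomplement would be Z, and u
   would be 0). The bijection phi carries nabla e, with this order and the
   orthocomplementation u |-> e - u, to a Boolean algebra. *)
Definition nabla_boolean_algebra e : Prop :=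
  exists (d : Order.disp_t) (L : ctbDistrLatticeType d) (phi : L -> (Z -> R)),
    [/\ set_bij [set: L] (nabla e) phi,
        (forall a b : L,
           (a <= b)%O <-> exposed (phi a) `<=` exposed (phi b)) &
        (forall a : L, phi (Order.compl a) = e \- phi a)].

End Spaces.

Section SpaceClasses.
Context {R : realType} (Z : normedModType R).

Definition weakly_facially_symmetric : Prop :=
  forall F : set Z, norm_exposed_face F -> symmetric_face F.

Definition strongly_facially_symmetric : Prop :=
  weakly_facially_symmetric /\
  forall (u g : Z -> R) (sym : Z -> Z),
    norm_exposed_face (exposed u) -> dual_sphere u -> dual_sphere g ->
    exposed u `<=` exposed g -> facial_symmetry (exposed u) sym ->
    g \o sym = g.

Definition neutral_space : Prop :=
  forall (u : Z -> R) (P : Z -> Z),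
    geometric_tripotent u -> peirce2 (exposed u) P -> neutral_projector P.

End SpaceClasses.

Definition direct_sum_property {R : realType} (d : measure_display)
    (T : measurableType d) (mu : {measure set T -> \bar R}) : Prop :=
  exists (I : Type) (A : I -> set T),
    [/\ trivIset [set: I] A,
        (forall i, measurable (A i) /\ (mu (A i) < +oo)%E) &
        forall B : set T, measurable B -> (mu B < +oo)%E ->
          exists (J : set I) (N : set T),
            [/\ countable J, measurable N, mu N = 0%E &
                B = (\bigcup_(j in J) (B `&` A j)) `|` N]].

(* LspaceType1 mu is the set of classes modulo mu-a.e. equality of measurable
   functions f with finite integral of |f|; the library gives it no vector space
   structure, so linearity is expressed a.e. on representatives. *)
Definition isometric_to_L1 {R : realType} (Z : normedModType R)
    (d : measure_display) (T : measurableType d)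
    (mu : {measure set T -> \bar R}) : Prop :=
  exists J : Z -> LspaceType1 mu,
    [/\ bijective J,
        (forall (a : R) (x y : Z),
           {ae mu, forall t, J (a *: x + y) t = a * J x t + J y t}) &
        (forall x : Z, (\int[mu]_t `|J x t|%:E = `|x|%:E)%E)].

(* Main.v *)
From HB Require Import structures.
From mathcomp Require Import finmap measurable_realfun ring lra.
Require Import Defs.

(** Put C = {x | e x = |x|}, the cone over the face F_e.  The hypothesis on the
    unit ball says that every x is a difference y - z of elements of C with
    |x| = |y| + |z|.  Let g be a norming functional of x, so that g y = |y| and
    g z = - |z|.  Then (g + e) / 2 exposes the face F_g /\ F_e, which contains
    y / |y| and is orthogonal to z / |z|.  In a strongly facially symmetric
    space a nonempty norm exposed face is the face of a geometric tripotent
    ([exposed_tripotent]), hence this one is the face of some u in nabla, and u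
    is a Hahn set of x: |x| = u x - (e - u) x ([hahn_decomposition]).  So x is
    determined by the set function u |-> u x on nabla, and its norm is the total
    variation of that set function.

    The symmetry S_u fixes e, hence splits every x in C into a part p in C
    concentrated on u and a part q in C vanishing on u, and v x = v p + v q for
    every v in nabla above u, below u or disjoint from u ([cone_split]).  It
    follows that u |-> u x is additive ([phi_disjoint]); as nabla is a Boolean
    algebra, v x = v p + v q then holds for all v, so the restriction of x to the
    part below u again comes from an element of Z ([phi_restrict]).  Finally the
    functionals of a filter in nabla converge pointwise, and the limit exposes a
    face in F_e, so an element of C has a smallest tripotent that carries it, its
    support ([phi_support]).  These facts are collected in [boolean_masses]; the
    rest of the proof uses only them and the completeness of Z.

    On the Stone space of nabla every nonnegative additive function on the
    clopen sets extends to a measure ([stone_representation]), so the elements of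
    C become measures, and they are stable under restriction to measurable sets
    ([measure_of_restrict]) and under bounded increasing limits ([pos_limit]).
    Take a maximal family of pairwise disjoint supports a of elements X a
    ([maximal_supports]), and let mu be the sum of the measures of the X a.  The
    clopen sets of the supports give the direct sum property.  An element of C
    that is maximal among those below y having a density with respect to mu must
    be y itself: otherwise the remainder charges some support a, and a Hahn set
    of its difference with a small multiple of X a provides a further piece with a
    density ([density_exists]).  The same exhaustion produces an element with a
    prescribed integrable density ([density_of_fun]).  Elements whose densities
    live on disjoint measurable sets have no common part, so the Hahn
    decomposition makes them additive for the norm ([density_norm]); applied to
    the positive and negative parts of a function, this identifies the norm of Z
    with that of L_1(mu). *)

Set Implicit Arguments.
Unset Strict Implicit.
Unset Printing Implicit Defensive.

Import Order.CTBDistrLatticeTheory.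

Local Open Scope classical_set_scope.
Local Open Scope ring_scope.

(** * Hahn-Banach: norming functionals *)

Section HahnBanach.
Context {R : realType} {V : lmodType R}.
Implicit Types (p q : V -> R) (x y : V).

Definition sublinear p : Prop :=
  (forall x y, p (x + y) <= p x + p y) /\
  (forall (t : R) x, 0 <= t -> p (t *: x) = t * p x).

Lemma sublinear0 p : sublinear p -> p 0 = 0.
Proof. by case=> _ /(_ 0 0 (lexx _)); rewrite scale0r mul0r. Qed.

Lemma sublinear_geN p x : sublinear p -> - p (- x) <= p x.
Proof.
move=> sp; rewrite -subr_ge0 opprK -(sublinear0 sp) -(subrr x).
exact: sp.1.
Qed.

(** The infimum of a downward directed family, in particular of a chain, is
    again sublinear: this gives the lower bounds that Zorn's lemma asks for. *)
Lemma sublinear_inf (A : set (V -> R)) (b : V -> R) :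
  A !=set0 -> (forall p, A p -> sublinear p) ->
  (forall p x, A p -> b x <= p x) ->
  (forall x y p q, A p -> A q -> exists2 r, A r & r x <= p x /\ r y <= q y) ->
  sublinear (fun x => inf [set p x | p in A]).
Proof.
move=> [p0 Ap0] sA bA dirA.
have hi x : has_inf [set p x | p in A].
  split; first by exists (p0 x), p0.
  by exists (b x) => _ [p Ap <-]; exact: bA.
have lei x p : A p -> inf [set p x | p in A] <= p x.
  by move=> Ap; apply: ge_inf; [exact: (hi x).2|exists p].
split=> [x y|t x t0].
  apply/ler_addgt0Pr => _/posnumP[e].
  have e2 : 0 < e%:num / 2 by [].
  have [_ [p Ap <-] hp] := inf_adherent e2 (hi x).
  have [_ [q Aq <-] hq] := inf_adherent e2 (hi y).
  have [r Ar [rp rq]] := dirA x y p q Ap Aq.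
  apply: (le_trans (lei _ _ Ar)); apply: (le_trans ((sA _ Ar).1 x y)).
  by rewrite [leRHS](_ : _ = (inf [set p x | p in A] + e%:num / 2) +
    (inf [set p y | p in A] + e%:num / 2)); [lra|field].
move: t0; rewrite le_eqVlt => /predU1P[<-|t0].
  rewrite mul0r scale0r; apply/eqP; rewrite eq_le; apply/andP; split.
    by rewrite -(sublinear0 (sA _ Ap0)); exact: lei.
  apply: lb_le_inf; first by exists (p0 0), p0.
  by move=> _ [p Ap <-]; rewrite (sublinear0 (sA _ Ap)).
apply/eqP; rewrite eq_le; apply/andP; split.
  rewrite -ler_pdivrMl//; apply: lb_le_inf; first by exists (p0 x), p0.
  by move=> _ [p Ap <-]; rewrite ler_pdivrMl// -((sA _ Ap).2 t x (ltW t0)) lei.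
apply: lb_le_inf; first by exists (p0 (t *: x)), p0.
by move=> _ [p Ap <-]; rewrite ((sA _ Ap).2 t x (ltW t0)) ler_pM2l// lei.
Qed.

(** The functional q x = inf_(t >= 0) p (x + t y) - t p y.  It serves twice: it
    shows that a minimal p is odd, and it forces the value at y of the linear
    functionals below it. *)
Lemma sublinear_shift p y : sublinear p -> exists q,
  [/\ sublinear q, forall x, q x <= p x & q (- y) <= - p y].
Proof.
move=> sp.
pose f (t : R) x := p (x + t *: y) - t * p y.
have fb t x : 0 <= t -> - p (- x) <= f t x.
  move=> t0; rewrite /f -(sp.2 t y t0).
  by have := sp.1 (x + t *: y) (- x); rewrite addrAC subrr add0r; lra.
pose q x := inf [set f t x | t in [set t | 0 <= t]].
have hi x : has_inf [set f t x | t in [set t | 0 <= t]].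
  split; first by exists (f 0 x), 0 => /=.
  by exists (- p (- x)) => _ [t t0 <-]; exact: fb.
have lei x t : 0 <= t -> q x <= f t x.
  by move=> t0; apply: ge_inf; [exact: (hi x).2|exists t].
exists q; split.
- split=> [x z|s x].
    apply/ler_addgt0Pr => _/posnumP[e].
    have e2 : 0 < e%:num / 2 by [].
    have [_ [t t0 <-] ht] := inf_adherent e2 (hi x).
    have [_ [t' t0' <-] ht'] := inf_adherent e2 (hi z).
    apply: (le_trans (lei _ (t + t') (addr_ge0 t0 t0'))).
    have : f (t + t') (x + z) <= f t x + f t' z.
      rewrite /f scalerDl addrACA mulrDl.
      by have := sp.1 (x + t *: y) (z + t' *: y); lra.
    rewrite -/(q _) -/(q _) in ht ht' *.
    by move: ht ht'; rewrite {1}(splitr e%:num) /=; lra.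
  rewrite le_eqVlt => /predU1P[<-|s0].
    rewrite scale0r mul0r; apply/eqP; rewrite eq_le; apply/andP; split.
      apply: (le_trans (lei 0 0 (lexx _))).
      by rewrite /f scale0r addr0 mul0r subr0 sublinear0.
    apply: lb_le_inf; first by exists (f 0 0), 0 => /=.
    move=> _ [t t0 <-]; apply: le_trans (fb _ _ t0).
    by rewrite oppr0 sublinear0// oppr0.
  have fs t : 0 <= t -> f (s * t) (s *: x) = s * f t x.
    by move=> t0; rewrite /f -scalerA -scalerDr (sp.2 s _ (ltW s0)); ring.
  apply/eqP; rewrite eq_le; apply/andP; split.
    rewrite -ler_pdivrMl//; apply: lb_le_inf; first by exists (f 0 x), 0 => /=.
    move=> _ [t t0 <-]; rewrite ler_pdivrMl// -fs//.
    by apply: lei; rewrite mulr_ge0// ltW.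
  apply: lb_le_inf; first by exists (f 0 (s *: x)), 0 => /=.
  move=> _ [t t0 <-].
  have -> : t = s * (t / s) by field; rewrite gt_eqF.
  have ts0 : 0 <= t / s by rewrite divr_ge0// ltW.
  by rewrite fs// ler_pM2l// lei.
- move=> x; apply: (le_trans (lei _ 0 (lexx _))).
  by rewrite /f scale0r addr0 mul0r subr0.
- apply: (le_trans (lei _ 1 ler01)).
  by rewrite /f scale1r addNr sublinear0// mul1r sub0r.
Qed.

(** A minimal sublinear functional q is linear: by minimality it equals its
    shift along y, so q (- y) = - q y, and an odd sublinear functional is
    additive. *)
Lemma sublinear_dominates_linear p : sublinear p ->
  exists2 g : V -> R, scalar g & forall x, g x <= p x.
Proof.
move=> sp.
pose T := {q : V -> R | sublinear q /\ forall x, q x <= p x}.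
pose rel (q r : T) := `[< forall x, sval r x <= sval q x >].
have [||A totA|[q [sq qp]] /= qmin] :=
    @ZL_preorder T (exist (fun q => sublinear q /\ forall x, q x <= p x) p
        (conj sp (fun x => lexx _))) rel.
- by move=> t; apply/asboolP.
- move=> q r s /asboolP rq /asboolP qs; apply/asboolP => x.
  exact: le_trans (qs x) (rq x).
- have [[q0 Aq0]|A0] := pselect (A !=set0); last first.
    exists (exist (fun q => sublinear q /\ forall x, q x <= p x) p
        (conj sp (fun x => lexx _))) => s As.
    by exfalso; apply: A0; exists s.
  pose B := [set sval q | q in A].
  have bB r x : B r -> - p (- x) <= r x.
    move=> [[r' [sr rp]] _ <- /=].
    by apply: le_trans (sublinear_geN x sr); rewrite lerN2.
  have sB : sublinear (fun x => inf [set r x | r in B]).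
    apply: (@sublinear_inf _ (fun x => - p (- x))) => //.
    + by exists (sval q0), q0.
    + by move=> _ [[r' [sr rp]] _ <-].
    + move=> x y _ _ [r Ar <-] [s As <-].
      by case: (totA _ _ Ar As) => /asboolP h;
        [exists (sval s)|exists (sval r)] => //; [exists s|exists r].
  have Ble r x : B r -> inf [set r x | r in B] <= r x.
    move=> Br; apply: ge_inf; last by exists r.
    by exists (- p (- x)) => _ [s Bs <-]; exact: bB.
  have Bp x : inf [set r x | r in B] <= p x.
    apply: (le_trans (Ble (sval q0) x _)); first by exists q0.
    exact: (proj2 (svalP q0)).
  exists (exist (fun q => sublinear q /\ forall x, q x <= p x) _ (conj sB Bp)).
  move=> s As; apply/asboolP => x /=.
  by apply: Ble; exists s.
have qN y : q (- y) = - q y.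
  have [r [sr rq ry]] := sublinear_shift y sq.
  have rp x : r x <= p x by exact: le_trans (rq x) (qp x).
  have /asboolP/= qr := qmin (exist _ r (conj sr rp)) (introT (asboolP _) rq).
  apply/eqP; rewrite eq_le (le_trans (qr _) ry)/=.
  by rewrite lerNl; exact: sublinear_geN.
have qD x y : q (x + y) = q x + q y.
  apply/eqP; rewrite eq_le sq.1/= -lerBrDr -qN.
  by rewrite -{1}(addrK y x) sq.1.
exists q => //.
suff qZ : forall a x, q (a *: x) = a * q x by move=> a x y; rewrite qD qZ.
move=> a x.
have [a0|a0] := leP 0 a; first exact: sq.2.
have na0 : 0 <= - a by rewrite oppr_ge0 ltW.
by rewrite -[a in LHS]opprK scaleNr qN (sq.2 _ x na0) mulNr opprK.
Qed.
End HahnBanach.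

(** A linear functional below the shift of the norm along x takes at - x a value
    at most - |x|. *)
Lemma norming_functional {R : realType} {Z : normedModType R} (x : Z) :
  exists2 g : Z -> R, scalar g & (forall y, `|g y| <= `|y|) /\ g x = `|x|.
Proof.
have sn : sublinear (fun y : Z => `|y|).
  by split=> [y z|t y t0]; [exact: ler_normD|rewrite normrZ ger0_norm].
have [p [sp pn px]] := sublinear_shift x sn.
have [g lg gp] := sublinear_dominates_linear sp.
have gn y : g y <= `|y| by exact: le_trans (gp y) (pn y).
have gN y : g (- y) = - g y.
  have := lg (-1) y 0; rewrite addr0 scaleN1r => ->.
  have := lg 1 0 0; rewrite scale1r addr0 mul1r => /esym/eqP.
  by rewrite -subr_eq0 addrK => /eqP->; rewrite addr0 mulN1r.
exists g => //; split=> [y|].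
  by rewrite ler_norml gn andbT lerNl -gN -(normrN y).
by apply/eqP; rewrite eq_le gn/= -lerN2 -gN; exact: le_trans (gp _) px.
Qed.

(** * The dual ball, orthogonality and closed spans *)

Section ScalarFunctions.
Context {R : realType} {V : lmodType R} (g : V -> R).
Hypothesis lg : scalar g.

Lemma scalarD x y : g (x + y) = g x + g y.
Proof. by have := lg 1 x y; rewrite scale1r mul1r. Qed.

Lemma scalar0 : g 0 = 0.
Proof. by have := scalarD 0 0; rewrite addr0; lra. Qed.

Lemma scalarZ t x : g (t *: x) = t * g x.
Proof. by have := lg t x 0; rewrite !addr0 scalar0 addr0. Qed.

Lemma scalarN x : g (- x) = - g x.
Proof. by rewrite -scaleN1r scalarZ mulN1r. Qed.

Lemma scalarB x y : g (x - y) = g x - g y.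
Proof. by rewrite scalarD scalarN. Qed.
End ScalarFunctions.

Section DualBall.
Context {R : realType} {Z : normedModType R}.
Implicit Types (x y z w : Z) (g h u : Z -> R) (F A : set Z).

(** The unit ball of the dual; unlike [dual_sphere] it asks for no point where
    the norm is attained or approached, and it is stable under averages. *)
Definition dual_ball g : Prop := scalar g /\ forall x, `|g x| <= `|x|.

Lemma dual_ball_le g x : dual_ball g -> g x <= `|x|.
Proof. by case=> _ /(_ x); apply: le_trans; exact: ler_norm. Qed.

Lemma dual_ball_leN g x : dual_ball g -> - g x <= `|x|.
Proof. by case=> _ /(_ x); apply: le_trans; rewrite -normrN ler_norm. Qed.

Lemma dual_ballN g : dual_ball g -> dual_ball (\- g).
Proof.
move=> [lg g1]; split=> [a x y|x] /=; last by rewrite normrN.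
by rewrite lg opprD mulrN.
Qed.

Lemma dual_ball_half g h : dual_ball g -> dual_ball h ->
  dual_ball (fun x => (g x + h x) / 2).
Proof.
move=> [lg g1] [lh h1]; split=> [a x y|x] /=.
  by rewrite lg lh; field.
rewrite normrM [ `|2^-1|]ger0_norm// ler_pdivrMr//.
by have := ler_normD (g x) (h x); have := g1 x; have := h1 x; lra.
Qed.

Lemma dual_ball_continuous g : dual_ball g -> continuous g.
Proof.
move=> [lg g1] x; apply/cvgrPdist_lt => e e0; near=> y.
rewrite -scalarB//; apply: le_lt_trans (g1 _) _; near: y.
by apply: cvgr_dist_lt => //; exact: cvg_id.
Unshelve. all: by end_near. Qed.

Lemma dual_sphere_ball g : dual_sphere g -> dual_ball g.
Proof.
move=> [[lg cg] g1]; split=> // x.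
have hs : has_sup [set `|g y| | y in (unit_ball : set Z)].
  by apply: contrapT => /sup_out h; move: g1; rewrite /dual_norm h => /esym/eqP;
    rewrite oner_eq0.
have [->|x0] := eqVneq x 0; first by rewrite scalar0// !normr0.
have nx : 0 < `|x| by rewrite normr_gt0.
suff : `|g (`|x|^-1 *: x)| <= 1.
  rewrite scalarZ// normrM normfV normr_id ler_pdivrMl// mulr1 //.
rewrite -g1; apply: ub_le_sup; first exact: hs.2.
exists (`|x|^-1 *: x) => //=.
by rewrite /unit_ball/= normrZ normfV normr_id mulVf// gt_eqF.
Qed.

Lemma exposed_norm g x : dual_ball g -> exposed g x -> `|x| = 1.
Proof.
move=> gb [x1 gx]; apply/eqP; rewrite eq_le [_ <= 1]x1/= -gx.
exact: dual_ball_le.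
Qed.

(** A functional of the dual ball that exposes a nonempty face has norm one, and
    its continuity comes for free. *)
Lemma dual_ball_sphere g x : dual_ball g -> exposed g x -> dual_sphere g.
Proof.
move=> gb [x1 gx]; split; first by split; [exact: gb.1|exact: dual_ball_continuous].
apply/eqP; rewrite eq_le; apply/andP; split.
  apply: ge_sup; first by exists `|g x|, x.
  by move=> _ [y y1 <-]; apply: le_trans (gb.2 y) y1.
have -> : 1 = `|g x| by rewrite gx normr1.
apply: ub_le_sup; last by exists x.
by exists 1 => _ [y y1 <-]; apply: le_trans (gb.2 y) y1.
Qed.

(** On the unit ball both functionals are at most 1, so their average is 1 only
    where both are.  This is how intersections of norm exposed faces are seen to
    be norm exposed. *)
Lemma exposed_half g h : dual_ball g -> dual_ball h ->
  exposed (fun x => (g x + h x) / 2) = exposed g `&` exposed h.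
Proof.
move=> gb hb; apply/seteqP; split=> x /=.
  move=> [x1 e1]; rewrite /exposed/=.
  have g1 : g x <= 1 by apply: le_trans (dual_ball_le x gb) x1.
  have h1 : h x <= 1 by apply: le_trans (dual_ball_le x hb) x1.
  by split; split => //; lra.
by move=> [[x1 g1] [_ h1]]; split=> //; rewrite g1 h1; lra.
Qed.

Lemma exposed_face g : dual_ball g -> face (exposed g).
Proof.
move=> gb; split.
- by move=> x [].
- move=> x y t /set_mem[x1 gx] /set_mem[y1 gy]; apply/mem_set.
  have t0 : 0 <= t%:num by [].
  have t1 : t%:num <= 1 by [].
  have -> : conv t x y = t%:num *: (x : Z) + (1 - t%:num) *: (y : Z) by [].
  move: (t%:num : R) t0 t1 => s s0 s1.
  have s1' : 0 <= 1 - s by rewrite subr_ge0.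
  split; last by rewrite (scalarD gb.1) !(scalarZ gb.1) gx gy; lra.
  rewrite /unit_ball/=; apply: le_trans (ler_normD _ _) _.
  rewrite !normrZ ger0_norm// [ `|1 - s|]ger0_norm//.
  rewrite [leRHS](_ : _ = s * 1 + (1 - s) * 1) ?lerD ?ler_wpM2l//; lra.
- move=> y z l y1 z1 /andP[l0 l1] [_ gl].
  have gy : g y <= 1 by apply: le_trans (dual_ball_le y gb) y1.
  have gz : g z <= 1 by apply: le_trans (dual_ball_le z gb) z1.
  move: gl; rewrite (scalarD gb.1) !(scalarZ gb.1) => gl.
  by split; split => //; nra.
Qed.

Lemma exposed_norm_exposed g : dual_sphere g -> norm_exposed_face (exposed g).
Proof.
by move=> gs; split; [apply/exposed_face/dual_sphere_ball|exists g].
Qed.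

(** A functional that norms x + y norms both x and y, hence every nonnegative
    combination of them. *)
Lemma normD_scale x y (s t : R) : `|x + y| = `|x| + `|y| -> 0 <= s -> 0 <= t ->
  `|s *: x + t *: y| = `|s *: x| + `|t *: y|.
Proof.
move=> xy s0 t0.
have [g lg [g1 gxy]] := norming_functional (x + y).
have gb : dual_ball g by [].
rewrite scalarD// in gxy.
have gx := dual_ball_le x gb; have gy := dual_ball_le y gb.
have gx' : g x = `|x| by lra.
have gy' : g y = `|y| by lra.
apply/eqP; rewrite eq_le ler_normD/=.
rewrite !normrZ !ger0_norm// -gx' -gy' -!(scalarZ lg) -(scalarD lg).
exact: dual_ball_le.
Qed.

Lemma orthogonal_scale x y (s t : R) : orthogonal x y -> 0 <= s -> 0 <= t ->
  orthogonal (s *: x) (t *: y).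
Proof.
move=> [h1 h2] s0 t0; split; first exact: normD_scale.
rewrite -scalerN -(normrN (t *: y)) -scalerN; apply: normD_scale => //.
by rewrite normrN.
Qed.

Lemma orthogonalC x y : orthogonal x y -> orthogonal y x.
Proof. by move=> [h1 h2]; split; [rewrite addrC h1|rewrite distrC h2]; rewrite addrC. Qed.

Lemma dual_ball_orthogonal g h x y : dual_ball g -> dual_ball h ->
  g x = `|x| -> g y = `|y| -> h x = `|x| -> h y = - `|y| -> orthogonal x y.
Proof.
move=> gb hb gx gy hx hy; split; apply/eqP; rewrite eq_le.
  by rewrite ler_normD/= -gx -gy -(scalarD gb.1) dual_ball_le.
rewrite -{1}(normrN y) ler_normD/= -hx -[ `|y|]opprK -hy -(scalarB hb.1).
exact: dual_ball_le.
Qed.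

Lemma cone_exposed g x : g x = `|x| -> x != 0 -> scalar g ->
  exposed g (`|x|^-1 *: x).
Proof.
move=> gx x0 lg.
have nx : `|x| != 0 by rewrite normr_eq0.
split; first by rewrite /unit_ball/= normrZ normfV normr_id mulVf.
by rewrite scalarZ// gx mulVf.
Qed.

Lemma cone_orthocomplement g x z : scalar g -> g x = `|x| ->
  orthocomplement (exposed g) z -> orthogonal z x.
Proof.
move=> lg gx oz; have [->|x0] := eqVneq x 0.
  by split; rewrite ?subr0 ?addr0 normr0 addr0.
have := orthogonal_scale (oz _ (cone_exposed gx x0 lg)) ler01 (normr_ge0 x).
by rewrite scale1r scalerA mulfV ?normr_eq0// scale1r.
Qed.

Lemma subset_closed_span F : F `<=` closed_span F.
Proof.
move=> x Fx; apply: subset_closure => A [_ FA]; exact: FA.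
Qed.

Lemma closure_approx A x (e : R) : closure A x -> 0 < e ->
  exists2 y, A y & `|x - y| < e.
Proof.
move=> clx e0; have [y [Ay]] := clx _ (nbhsx_ballx x e e0).
by rewrite -ball_normE /= => xy; exists y.
Qed.

Lemma closed_span_ind F A : linear_subspace A -> F `<=` A ->
  (forall x, (forall e : R, 0 < e -> exists2 y, A y & `|x - y| < e) -> A x) ->
  closed_span F `<=` A.
Proof.
move=> sA FA clA x xF; apply: clA => e e0.
have [y yF xy] := closure_approx xF e0; exists y => //; exact: yF.
Qed.

Lemma closed_span_eq F g h : dual_ball g -> dual_ball h ->
  {in F, g =1 h} -> {in closed_span F, g =1 h}.
Proof.
move=> gb hb gh x /set_mem; move: x.
apply: (@closed_span_ind _ [set x | g x = h x]).
- split; first by rewrite /= !scalar0//; [exact: hb.1|exact: gb.1].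
  by move=> a x y /= gx gy; rewrite gb.1 hb.1 gx gy.
- by move=> x Fx; rewrite /= gh//; exact/mem_set.
move=> x ax /=; apply/eqP; rewrite -subr_eq0 -normr_le0.
apply/ler_addgt0Pr => e e0; rewrite add0r.
have e2 : 0 < e / 2 by rewrite divr_gt0.
have [y /= ghy xy] := ax _ e2.
have -> : g x - h x = g (x - y) - h (x - y).
  by rewrite (scalarB gb.1) (scalarB hb.1) ghy; lra.
apply: le_trans (ler_normB _ _) _.
by have := gb.2 (x - y); have := hb.2 (x - y); lra.
Qed.

(** The vectors with g x = |x| form a convex cone containing the face of g, so
    the linear span of the face consists of differences of such vectors; a closed
    property of these differences passes to the closed span. *)
Lemma closed_span_cone g (B : Z -> Prop) : dual_ball g ->
  (forall c d, g c = `|c| -> g d = `|d| -> B (c - d)) ->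
  (forall x, (forall e : R, 0 < e -> exists2 y, B y & `|x - y| < e) -> B x) ->
  closed_span (exposed g) `<=` [set x | B x].
Proof.
move=> gb Bcd clB x xF; apply: clB => e e0.
have [y yF xy] := closure_approx xF e0; exists y => //.
pose A := [set w | exists c d, [/\ w = c - d, g c = `|c| & g d = `|d|]].
suff [c [d [-> cc dd]]] : A y by exact: Bcd.
have coneD c d : g c = `|c| -> g d = `|d| -> g (c + d) = `|c + d|.
  move=> gc gd; apply/eqP; rewrite eq_le dual_ball_le//= (scalarD gb.1) gc gd.
  exact: ler_normD.
have coneZ (t : R) c : 0 <= t -> g c = `|c| -> g (t *: c) = `|t *: c|.
  by move=> t0 gc; rewrite (scalarZ gb.1) normrZ ger0_norm// gc.
apply: yF; split; last first.
  move=> f Ff; exists f, 0; rewrite subr0 normr0 (scalar0 gb.1); split=> //.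
  by rewrite (exposed_norm gb Ff); case: Ff.
split; first by exists 0, 0; rewrite subr0 normr0 (scalar0 gb.1).
move=> a _ _ [c [d [-> gc gd]]] [c' [d' [-> gc' gd']]].
have [a0|a0] := leP 0 a.
  exists (a *: c + c'), (a *: d + d'); split; [|by apply/coneD/gc'/coneZ
    |by apply/coneD/gd'/coneZ].
  by rewrite scalerBr addrACA opprD.
have na0 : 0 <= - a by rewrite oppr_ge0 ltW.
exists ((- a) *: d + c'), ((- a) *: c + d'); split; [|by apply/coneD/gc'/coneZ
  |by apply/coneD/gd'/coneZ].
by rewrite scalerBr !scaleNr opprD opprK [a *: c - _]addrC addrACA.
Qed.
End DualBall.

(** * Facial symmetries and geometric tripotents *)

Lemma half_double {R : realType} {V : lmodType R} (x : V) :
  2^-1 *: (x + x) = x.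
Proof.
by rewrite scalerDr -scalerDl (_ : 2^-1 + 2^-1 = 1 :> R) ?scale1r//; field.
Qed.

Section FacialSymmetry.
Context {R : realType} {Z : normedModType R}.
Implicit Types (x y z w : Z) (g h u : Z -> R) (F A : set Z) (sym : Z -> Z).

(** Write w = c - d with c, d in the cone of the face.  Functionals p and q that
    norm z + (c + d) and z - (c + d) norm c, d and z up to sign, and their average
    u exposes a face containing z / |z|.  Both c and d are orthogonal to this
    face, and the orthocomplement of a symmetric face is a linear subspace, so
    c - d is orthogonal to z as well. *)
Lemma closed_span_norm g w z : weakly_facially_symmetric Z -> dual_ball g ->
  closed_span (exposed g) w -> orthocomplement (exposed g) z ->
  `|w + z| = `|w| + `|z|.
Proof.
move=> wfs gb wF zF; move: w wF.
apply: (closed_span_cone (B := fun w => `|w + z| = `|w| + `|z|)) => //.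
  move=> c d gc gd.
  have [->|z0] := eqVneq z 0; first by rewrite normr0 !addr0.
  have gcd : g (c + d) = `|c + d|.
    apply/eqP; rewrite eq_le dual_ball_le//= (scalarD gb.1) gc gd.
    exact: ler_normD.
  have ncd : `|c + d| = `|c| + `|d| by rewrite -gcd (scalarD gb.1) gc gd.
  have [zf zf'] := cone_orthocomplement gb.1 gcd zF.
  have [p lp [p1 pz]] := norming_functional (z + (c + d)).
  have [q lq [q1 qz]] := norming_functional (z - (c + d)).
  have pb : dual_ball p by []. have qb : dual_ball q by [].
  have qb' := dual_ballN qb.
  rewrite zf !(scalarD lp) ncd in pz.
  rewrite zf' (scalarB lq) (scalarD lq) ncd in qz.
  have [pz' pc pd] : [/\ p z = `|z|, p c = `|c| & p d = `|d|].
    have := dual_ball_le z pb; have := dual_ball_le c pb.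
    by have := dual_ball_le d pb; split; lra.
  have [qz' qc qd] : [/\ q z = `|z|, q c = - `|c| & q d = - `|d|].
    have := dual_ball_le z qb; have := dual_ball_leN c qb.
    by have := dual_ball_leN d qb; split; lra.
  (* u is 1 at z / |z| and 0 at c and d. *)
  pose u x := (p x + q x) / 2.
  have ub : dual_ball u := dual_ball_half pb qb.
  have uz : exposed u (`|z|^-1 *: z).
    by apply: cone_exposed => //; [rewrite /u pz' qz'; lra|exact: ub.1].
  have us := dual_ball_sphere ub uz.
  have [sym [_ _ _ [_ [_ sub] _ _] _]] := wfs _ (exposed_norm_exposed us).
  have mem b : p b = `|b| -> q b = - `|b| -> orthocomplement (exposed u) b.
    move=> pb' qb'' y uy; apply/orthogonalC; have yn := exposed_norm ub uy.
    have [[_ py] [_ qy]] : (exposed p `&` exposed q) y by rewrite -exposed_half.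
    by apply: (dual_ball_orthogonal pb qb); rewrite ?yn.
  have := sub (-1) d c (mem d pd qd) (mem c pc qc).
  rewrite scaleN1r [- d + c]addrC => /(_ _ uz) [+ _].
  move=> /normD_scale /(_ ler01 (normr_ge0 z)).
  by rewrite scale1r scalerA mulfV ?normr_eq0// scale1r.
move=> x ax; apply/eqP; rewrite -subr_eq0 -normr_le0.
apply/ler_addgt0Pr => e e0; rewrite add0r.
have e2 : 0 < e / 2 by rewrite divr_gt0.
have [y yz xy] := ax _ e2.
have -> : `|x + z| - (`|x| + `|z|) = (`|x + z| - `|y + z|) - (`|x| - `|y|).
  by rewrite yz; lra.
apply: le_trans (ler_normB _ _) _.
have := ler_dist_dist x y; have := ler_dist_dist (x + z) (y + z).
have -> : x + z - (y + z) = x - y by rewrite opprD addrACA subrr addr0.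
by lra.
Qed.

Section Peirce.
Variables (F : set Z) (sym : Z -> Z).
Hypothesis fs : facial_symmetry F sym.

Lemma sym_span x : closed_span F x -> sym x = x.
Proof.
have [_ _ _ [_ [c0 _] _ _] fixE] := fs => xF.
suff : [set x | sym x = x] x by [].
by rewrite fixE; exists x => //; exists 0 => //; rewrite addr0.
Qed.

Lemma sym_orthocomplement x : orthocomplement F x -> sym x = x.
Proof.
have [_ _ _ [[c0 _] _ _ _] fixE] := fs => xF.
suff : [set x | sym x = x] x by [].
by rewrite fixE; exists 0 => //; exists x => //; rewrite add0r.
Qed.

Lemma peirce_decomposition x : exists p q,
  [/\ closed_span F p, orthocomplement F q & 2^-1 *: (x + sym x) = p + q].
Proof.
have [ls _ inv _ fixE] := fs.
have symD y z : sym (y + z) = sym y + sym z.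
  by have := ls 1 y z; rewrite !scale1r.
have sym0 : sym 0 = 0.
  by have := ls (-1) 0 0; rewrite scaler0 addr0 scaleN1r addNr.
have symZ a y : sym (a *: y) = a *: sym y.
  by have := ls a y 0; rewrite !addr0 sym0 addr0.
have : [set x | sym x = x] (2^-1 *: (x + sym x)).
  by rewrite /= symZ symD inv addrC.
by rewrite fixE => -[p pF [q qF <-]]; exists p, q.
Qed.

Lemma peirce_unique p q p' q' : closed_span F p -> orthocomplement F q ->
  closed_span F p' -> orthocomplement F q' -> p + q = p' + q' -> p = p'.
Proof.
have [_ _ _ [[s0 sS] [c0 cS] I0 _] _] := fs => pF qF p'F q'F e.
apply/eqP; rewrite -subr_eq0; apply/eqP.
have : (closed_span F `&` orthocomplement F) (p - p').
  split; first by rewrite addrC -scaleN1r; exact: sS.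
  have -> : p - p' = q' - q by apply/eqP; rewrite subr_eq addrAC eq_sym subr_eq addrC e addrC.
  by rewrite addrC -scaleN1r; exact: cS.
by rewrite I0.
Qed.
End Peirce.

(** The tripotent is v = g o P with P the projection onto the closed span of the
    face along its orthocomplement.  If |x| <= 1 and v x = 1 then |P x| = 1, which
    leaves no room for the orthogonal component of x, so g x = v x. *)
Lemma exposed_tripotent g : strongly_facially_symmetric Z -> dual_ball g ->
  exposed g !=set0 -> exists2 v, geometric_tripotent v & exposed v = exposed g.
Proof.
move=> [wfs sfs] gb [f0 Ff0].
have gs := dual_ball_sphere gb Ff0; have ne := exposed_norm_exposed gs.
set F := exposed g in ne Ff0 *.
have [sym fs] := wfs _ ne.
have gsym x : g (sym x) = g x.
  exact: (congr1 (@^~ x) (sfs g g sym ne gs gs (@subset_refl _ _) fs)).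
have [ls ns inv [[s0 sS] [c0 cS] I0 _] fixE] := fs.
have /choice[P /= hP] x := peirce_decomposition fs x.
have /choice[Q {}hP] := hP.
have PF x : closed_span F (P x) by case: (hP x).
have QF x : orthocomplement F (Q x) by case: (hP x).
have PQ x : 2^-1 *: (x + sym x) = P x + Q x by case: (hP x).
have nPQ x : `|P x| + `|Q x| <= `|x|.
  rewrite -(closed_span_norm wfs gb (PF x) (QF x)) -PQ normrZ ger0_norm//.
  by rewrite mulrC ler_pdivrMr//; have := ler_normD x (sym x); rewrite ns; lra.
have PE x p q : closed_span F p -> orthocomplement F q ->
    2^-1 *: (x + sym x) = p + q -> P x = p.
  move=> pF qF e; apply: (peirce_unique fs (PF x) (QF x) pF qF).
  by rewrite -PQ.
have PL : linear P.
  move=> a x y; apply: (PE _ _ (a *: Q x + Q y)); [exact: sS|exact: cS|].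
  rewrite /= [RHS]addrACA -scalerDr -!PQ ls scalerA mulrC -scalerA -scalerDr.
  by rewrite [a *: (x + _)]scalerDr addrACA.
have PT x : closed_span F x -> P x = x.
  move=> xF; apply: (PE _ _ 0) => //; rewrite (sym_span fs xF) addr0.
  exact: half_double.
have P0 x : orthocomplement F x -> P x = 0.
  move=> xF; apply: (PE _ _ x) => //; rewrite (sym_orthocomplement fs xF) add0r.
  exact: half_double.
have Ps x : P (sym x) = P x.
  by apply: (PE _ _ (Q x)) => //; rewrite -PQ inv addrC.
pose v x := g (P x).
have vb : dual_ball v.
  split; first by move=> a x y; rewrite /v PL gb.1.
  by move=> x; apply: le_trans (gb.2 _) _; have := nPQ x; have := normr_ge0 (Q x); lra.
have FS := @subset_closed_span _ _ F.
have gPQ x : g x = v x + g (Q x).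
  rewrite /v -(scalarD gb.1) -PQ (scalarZ gb.1) (scalarD gb.1) gsym; lra.
have vF : exposed v = F.
  apply/seteqP; split=> x [x1 ex].
    split=> //; rewrite gPQ ex.
    have : 1 <= `|P x| by rewrite -ex; exact: (dual_ball_le (P x) gb).
    have := nPQ x => h1 h2; have x1' : `|x| <= 1 := x1.
    have /eqP : `|Q x| = 0 by apply/eqP; rewrite eq_le normr_ge0 andbT; lra.
    by rewrite normr_eq0 => /eqP->; rewrite (scalar0 gb.1) addr0.
  by split=> //; rewrite /v PT//; apply: FS.
exists v => //; split; [split|].
- by apply: (dual_ball_sphere vb (x := f0)); rewrite vF.
- by move=> y; rewrite vF => /P0; rewrite /v => ->; rewrite (scalar0 gb.1).
- by exists sym; [rewrite vF|apply/funext => x /=; rewrite /v Ps].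
Qed.

End FacialSymmetry.

(** * The Boolean algebra of geometric tripotents below e *)

(** The elements of Z are seen as finitely additive functions on L through
    x |-> (a |-> m a x).  The norm is the total variation and is attained on a
    Hahn set ([mass_le_norm], [mass_norm]); the space is stable under restriction
    to an element of L ([mass_restrict]); and the nonnegative functions in it are
    normal, in the sense that they have a support ([mass_support]). *)
Record boolean_masses (R : realType) (Z : normedModType R) (d : Order.disp_t)
    (L : ctbDistrLatticeType d) (m : L -> Z -> R) : Prop := BooleanMasses {
  mass_nontrivial : (\top : L)%O <> (\bot)%O;
  mass_scalar : forall a, scalar (m a);
  mass_disjoint : forall a b x, (a `&` b = \bot)%O ->
    m (a `|` b)%O x = m a x + m b x;
  mass_le_norm : forall a x, m a x - m (~` a)%O x <= `|x|;
  mass_norm : forall x, exists a, `|x| = m a x - m (~` a)%O x;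
  mass_restrict : forall a x, exists y, forall b, m b y = m (a `&` b)%O x;
  mass_support : forall x, (forall a, 0 <= m a x) -> exists a,
    m a x = m \top%O x /\ forall b, m b x = m \top%O x -> (a <= b)%O
}.

Section Geometry.
Context {R : realType} {Z : normedModType R} {e : Z -> R}.
Context {d : Order.disp_t} {L : ctbDistrLatticeType d} {phi : L -> Z -> R}.
Hypothesis sfs : strongly_facially_symmetric Z.
Hypothesis e_tripotent : geometric_tripotent e.
Hypothesis hull :
  (unit_ball : set Z) = convex_hull (exposed e `|` exposed (\- e)).
Hypothesis phi_bij : set_bij [set: L] (nabla e) phi.
Hypothesis phi_le :
  forall a b, (a <= b)%O <-> exposed (phi a) `<=` exposed (phi b).
Hypothesis phi_compl : forall a, phi (~` a)%O = e \- phi a.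
Implicit Types (x y z p q : Z) (a b c : L) (g h : Z -> R).

Lemma tripotent_ball g : geometric_tripotent g -> dual_ball g.
Proof. by case=> -[/dual_sphere_ball]. Qed.

Let eb : dual_ball e. Proof. exact: tripotent_ball. Qed.

Let cone x := e x = `|x|.

Lemma coneD x y : cone x -> cone y -> cone (x + y).
Proof.
rewrite /cone => ex ey; apply/eqP; rewrite eq_le dual_ball_le//=.
by rewrite (scalarD eb.1) ex ey ler_normD.
Qed.

Lemma coneZ (t : R) x : 0 <= t -> cone x -> cone (t *: x).
Proof. by rewrite /cone => t0 ex; rewrite (scalarZ eb.1) normrZ ger0_norm// ex. Qed.

Lemma cone0 : cone 0. Proof. by rewrite /cone (scalar0 eb.1) normr0. Qed.

(** The differences y - z with y, z in the cone and |y| + |z| <= 1 form a convex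
    set that contains F_e and F_(-e), hence the unit ball. *)
Lemma cone_decomposition x : exists y z,
  [/\ cone y, cone z, x = y - z & `|x| = `|y| + `|z|].
Proof.
pose D := [set w | exists y z,
  [/\ cone y, cone z, w = y - z & `|y| + `|z| <= 1]].
have ballD : (unit_ball : set Z) `<=` D.
  rewrite hull; apply: smallest_sub => [v w t /set_mem Dv /set_mem Dw|].
    apply/mem_set; move: Dv Dw => [y [z [cy cz -> yz]]] [y' [z' [cy' cz' -> yz']]].
    have -> : conv t (y - z : convex_lmodType Z) (y' - z' : convex_lmodType Z) =
        t%:num *: (y - z) + (1 - t%:num) *: (y' - z') by [].
    have s0 : 0 <= t%:num by []. have : t%:num <= 1 by [].
    rewrite -subr_ge0; move: (t%:num) s0 => s s0 s1.
    exists (s *: y + (1 - s) *: y'), (s *: z + (1 - s) *: z'); split.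
    - by apply: coneD; exact: coneZ.
    - by apply: coneD; exact: coneZ.
    - by rewrite !scalerBr opprD addrACA.
    - have := ler_normD (s *: y) ((1 - s) *: y').
      have := ler_normD (s *: z) ((1 - s) *: z').
      by rewrite !normrZ ger0_norm// [ `|1 - s|]ger0_norm//; nra.
  move=> w [ew|ew].
    exists w, 0; rewrite subr0 normr0 addr0; split=> //; last by case: ew.
      by rewrite /cone (exposed_norm eb ew); case: ew.
    exact: cone0.
  have en := exposed_norm (dual_ballN eb) ew.
  exists 0, (- w); rewrite opprK add0r normr0 add0r normrN en; split=> //.
    exact: cone0.
  by rewrite /cone (scalarN eb.1) normrN en; case: ew.
have [->|x0] := eqVneq x 0.
  by exists 0, 0; rewrite subr0 normr0 addr0; split=> //; exact: cone0.
have nx : 0 < `|x| by rewrite normr_gt0.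
have [|y [z [cy cz xyz yz]]] := ballD (`|x|^-1 *: x).
  by rewrite /unit_ball/= normrZ normfV normr_id mulVf// gt_eqF.
exists (`|x| *: y), (`|x| *: z).
have xE : x = `|x| *: y - `|x| *: z.
  by rewrite -scalerBr -xyz scalerA mulfV ?gt_eqF// scale1r.
split=> //; [exact: coneZ|exact: coneZ|].
apply/eqP; rewrite eq_le {1}xE ler_normB/=.
by rewrite !normrZ normr_id -mulrDr ler_piMr.
Qed.

Lemma scalar_eq_on_cone g h : scalar g -> scalar h ->
  (forall x, cone x -> g x = h x) -> forall x, g x = h x.
Proof.
move=> lg lh gh x; have [y [z [cy cz -> _]]] := cone_decomposition x.
by rewrite !scalarB// !gh.
Qed.

Lemma phi_nabla a : nabla e (phi a).
Proof. by case: phi_bij => + _ _; apply. Qed.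

Lemma nabla_phi g : nabla e g -> exists a, phi a = g.
Proof. by case: phi_bij => _ _ + /[dup] ng => /[apply]-[a _ <-]; exists a. Qed.

Lemma phi_ball a : dual_ball (phi a).
Proof.
have [[ga _]|->] := phi_nabla a; first exact: tripotent_ball.
by split=> [? ? ?|x] /=; rewrite ?mulr0 ?addr0// normr0.
Qed.

Lemma phi_sub_e a : exposed (phi a) `<=` exposed e.
Proof.
have [[_ //]|->] := phi_nabla a.
by move=> x [_ /= /esym/eqP]; rewrite oner_eq0.
Qed.

Lemma phi_top : phi \top%O = e.
Proof.
have [a ea] : exists a, phi a = e.
  by apply: nabla_phi; left; split.
rewrite -ea; congr phi; apply/eqP; rewrite eq_le lex1 andbT.
by apply/phi_le; rewrite ea; exact: phi_sub_e.
Qed.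

Lemma phi_bot : phi \bot%O = cst 0.
Proof.
rewrite -compl1 phi_compl phi_top; apply/funext => x /=; exact: subrr.
Qed.

Lemma phi_complE a x : phi (~` a)%O x = e x - phi a x.
Proof. by rewrite phi_compl. Qed.

Lemma phi_nonempty a : exposed (phi a) !=set0 \/ phi a = cst 0.
Proof.
have [?|e0] := pselect (exposed (phi a) !=set0); [by left|right].
have [[[[_ u0] _] _]//|//] := phi_nabla a.
apply/funext => x; apply: u0 => y ay; exfalso; apply: e0; by exists y.
Qed.

Lemma phi_le_nonempty a b : (a <= b)%O -> exposed (phi a) !=set0 ->
  dual_sphere (phi b).
Proof.
move=> /phi_le ab [f /ab Ff]; exact: (dual_ball_sphere (phi_ball b) Ff).
Qed.

Lemma cone_exposedE g x : dual_ball g -> cone x -> x != 0 ->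
  exposed g (`|x|^-1 *: x) <-> g x = e x.
Proof.
rewrite /cone => gb cx x0; rewrite cx; split; last first.
  by move=> gx; apply: cone_exposed => //; exact: gb.1.
move=> [_]; rewrite (scalarZ gb.1) => h.
by rewrite -[LHS](mulVKf (x := `|x|)) ?normr_eq0// h mulr1.
Qed.

(** The average of g and e exposes the face F_g /\ F_e below e, so the set where
    g and e agree on the cone is described by an element of nabla, whatever g is.
    This is the only source of elements of nabla in the construction of meets and
    supports. *)
Lemma functional_component g : dual_ball g ->
  exists c, forall x, cone x -> phi c x = e x <-> g x = e x.
Proof.
move=> gb; pose h x := (g x + e x) / 2.
have hb : dual_ball h := dual_ball_half gb eb.
have hF : exposed h = exposed g `&` exposed e := exposed_half gb eb.
have eF x : cone x -> x != 0 -> exposed e (`|x|^-1 *: x).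
  by move=> cx x0; apply/cone_exposedE.
have [h0|h0] := pselect (exposed h !=set0).
  have [v tv vF] := exposed_tripotent sfs hb h0.
  have [c cv] : exists c, phi c = v.
    by apply: nabla_phi; left; split=> //; rewrite vF hF; exact: subIsetr.
  exists c => x cx; have [->|x0] := eqVneq x 0.
    by rewrite !scalar0//; [exact: gb.1|exact: eb.1|exact: (phi_ball c).1].
  rewrite -(cone_exposedE (phi_ball c) cx x0) -(cone_exposedE gb cx x0).
  by rewrite cv vF hF; split=> [[]//|gx]; split=> //; exact: eF.
exists \bot%O => x cx; rewrite phi_bot /=; have [->|x0] := eqVneq x 0.
  by rewrite !scalar0//; [exact: gb.1|exact: eb.1].
split=> [|gx].
  by rewrite cx => /esym/eqP; rewrite normr_eq0 (negbTE x0).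
exfalso; apply: h0; exists (`|x|^-1 *: x); rewrite hF; split; last exact: eF.
exact/cone_exposedE.
Qed.

(** The component of the average of phi a and phi b exposes the intersection of
    their faces, so it is their meet. *)
Lemma phi_meet_full a b x : cone x -> phi a x = e x -> phi b x = e x ->
  phi (a `&` b)%O x = e x.
Proof.
move=> cx ax bx.
have [c cP] := functional_component (dual_ball_half (phi_ball a) (phi_ball b)).
have cab : (c <= a `&` b)%O.
  rewrite lexI; apply/andP; split; apply/phi_le => f cf;
    (have ef := phi_sub_e cf); (have f1 := exposed_norm (phi_ball c) cf);
    (have cf' : cone f by rewrite /cone f1; case: ef);
    have := (cP f cf').1; (have [_ ->] := cf); (have [_ ->] := ef);
    move=> /(_ erefl); have := dual_ball_le f (phi_ball a);
    have := dual_ball_le f (phi_ball b); rewrite f1 => ? ? ?;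
    by split; [rewrite /unit_ball/= f1|lra].
have [x0|x0] := eqVneq x 0.
  by rewrite x0 !scalar0//; [exact: eb.1|exact: (phi_ball _).1].
apply/cone_exposedE => //; first exact: phi_ball.
move/phi_le : cab; apply; apply/cone_exposedE => //; first exact: phi_ball.
by apply/cP => //; rewrite ax bx; lra.
Qed.

Lemma hahn_decomposition x : exists a, `|x| = phi a x - phi (~` a)%O x.
Proof.
have [y [z [cy cz xyz nxyz]]] := cone_decomposition x.
have [g lg [g1 gx]] := norming_functional x; have gb : dual_ball g by [].
have gyz : g y = `|y| /\ g z = - `|z|.
  have := dual_ball_le y gb; have := dual_ball_leN z gb.
  by move: gx; rewrite {1}xyz (scalarB lg) nxyz; split; lra.
have [gy gz] := gyz.
have [y0|y0] := eqVneq y 0.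
  exists \bot%O; rewrite compl0 phi_top phi_bot /= nxyz xyz y0 (scalarB eb.1).
  by rewrite (scalar0 eb.1) normr0 cz; lra.
pose h x := (g x + e x) / 2.
have hb : dual_ball h := dual_ball_half gb eb.
have hF : exposed h = exposed g `&` exposed e := exposed_half gb eb.
have yF : exposed h (`|y|^-1 *: y).
  by rewrite hF; split; apply/cone_exposedE => //; rewrite gy cy.
have [v tv vF] := exposed_tripotent sfs hb (ex_intro _ _ yF).
have [a av] : exists a, phi a = v.
  by apply: nabla_phi; left; split=> //; rewrite vF hF; exact: subIsetr.
exists a; rewrite phi_complE av.
have vy : v y = e y.
  by apply/cone_exposedE => //; [exact: tripotent_ball|rewrite vF].
have vz : v z = 0.
  have [[_ ->]//] := tv; move=> f; rewrite vF hF => -[gf ef].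
  have f1 := exposed_norm eb ef; apply/orthogonalC.
  have := dual_ball_orthogonal eb gb (x := f) (y := z); apply.
  - by case: ef => _ ->.
  - exact: cz.
  - by case: gf => _ ->.
  - exact: gz.
have lv := (tripotent_ball tv).1.
rewrite xyz (scalarB lv) (scalarB eb.1) vy vz -xyz nxyz cy cz; lra.
Qed.

(** A functional invariant under the symmetry does not see the antisymmetric
    part (x - sym x) / 2. *)
Lemma sym_split sym g x p q : scalar g -> g \o sym = g ->
  2^-1 *: (x + sym x) = p + q -> g x = g p + g q.
Proof.
move=> lg gs pq; rewrite -(scalarD lg) -pq (scalarZ lg) (scalarD lg).
by rewrite -[g (sym x)]/((g \o sym) x) gs; lra.
Qed.

(** The symmetry of a fixes the face of b pointwise, since this face lies in
    that of a.  Hence g = phi b o sym is 1 on the face of b, so it is invariant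
    under the symmetry tau of b as phi b is, and it is enough to compare them on
    the two summands fixed by tau. *)
Lemma phi_sym_below a b sym : (b <= a)%O -> facial_symmetry (exposed (phi a)) sym ->
  phi b \o sym = phi b.
Proof.
move=> ba fs; have [ls ns inv _ _] := fs.
have [[f0 f0b]|b0] := phi_nonempty b; last first.
  by rewrite b0.
have bb := phi_ball b; have bs := dual_ball_sphere bb f0b.
have bne := exposed_norm_exposed bs.
have [tau ft] := sfs.1 _ bne.
have symF f : exposed (phi b) f -> sym f = f.
  by move=> fb; apply: (sym_span fs); apply: subset_closed_span;
    move/phi_le : ba; exact.
pose g := phi b \o sym.
have gb : dual_ball g.
  by split=> [t x y|x]; rewrite /g /= ?ls ?bb.1// -(ns x); exact: bb.2.
have gF : exposed (phi b) `<=` exposed g.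
  by move=> f fb; have [f1 fe] := fb; split=> //; rewrite /g /= symF.
have gs := dual_ball_sphere gb (gF _ f0b).
have gt := sfs.2 _ _ _ bne bs gs gF ft.
have bt := sfs.2 _ _ _ bne bs bs (@subset_refl _ _) ft.
rewrite -/g; apply/funext => x.
(* Compare g and phi b on the summands of x for the symmetry of b. *)
have [p [q [pF qF pq]]] := peirce_decomposition ft x.
rewrite (sym_split gb.1 gt pq) (sym_split bb.1 bt pq); congr (_ + _).
  apply: (closed_span_eq gb bb (F := exposed (phi b))); last exact/mem_set.
  by move=> f /set_mem fb; rewrite /g /= symF.
have bq0 y : orthocomplement (exposed (phi b)) y -> phi b y = 0.
  have [[[[_ +] _] _]|b0] := phi_nabla b; first exact.
  by move: f0b; rewrite b0 => -[_ /= /esym/eqP]; rewrite oner_eq0.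
rewrite /g /= !bq0// => f fb.
have symB y z : sym (y - z) = sym y - sym z.
  by rewrite [y - z]addrC -[- z]scaleN1r ls scaleN1r addrC.
have symD y z : sym (y + z) = sym y + sym z.
  by have := ls 1 y z; rewrite !scale1r.
have [h1 h2] := qF _ fb.
by split; rewrite -{1}(symF _ fb) -?symB -?symD !ns.
Qed.

(** The components p and q of (x + sym x) / 2.  Since e is invariant under sym,
    e p + e q = |x| >= |p + q| = |p| + |q|, so both lie in the cone. *)
Lemma cone_split a x : cone x -> exists p q,
  [/\ cone p, cone q, phi a p = e p, phi a q = 0 &
      forall b, [|| a <= b, b <= a | b <= ~` a]%O -> phi b x = phi b p + phi b q].
Proof.
move=> cx; have [[f0 f0a]|a0] := phi_nonempty a; last first.
  exists 0, x; rewrite a0 (scalar0 eb.1); split=> //; first exact: cone0.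
  by move=> b _; rewrite (scalar0 (phi_ball b).1) add0r.
have ab := phi_ball a; have as_ := dual_ball_sphere ab f0a.
have ane := exposed_norm_exposed as_.
have [sym fs] := sfs.1 _ ane.
have [p [q [pF qF pq]]] := peirce_decomposition fs x.
have bsym b : (a <= b)%O -> phi b \o sym = phi b.
  move=> leab; have bs := phi_le_nonempty leab (ex_intro _ _ f0a).
  by apply: (sfs.2 _ _ _ ane as_ bs) => //; apply/phi_le.
have esplit : e x = e p + e q.
  by apply: (sym_split eb.1 _ pq); rewrite -phi_top; apply: bsym; exact: lex1.
have [cp cq] : cone p /\ cone q.
  have [_ ns _ _ _] := fs.
  have := closed_span_norm sfs.1 ab pF qF; rewrite -pq normrZ ger0_norm// => h.
  have := ler_normD x (sym x); rewrite ns.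
  have := dual_ball_le p eb; have := dual_ball_le q eb; move: cx; rewrite /cone.
  by split; lra.
exists p, q; split=> //.
- apply: (closed_span_eq ab eb (F := exposed (phi a))); last exact/mem_set.
  by move=> f /set_mem fa; have [_ ->] := fa; have [_ ->] := phi_sub_e fa.
- have [[[[_ +] _] _]|->//] := phi_nabla a; exact.
- move=> b /or3P[leab|leba|leba].
  + by apply: (sym_split (phi_ball b).1 _ pq); exact: bsym.
  + by apply: (sym_split (phi_ball b).1 _ pq); exact: phi_sym_below leba fs.
  + have leab : (a <= ~` b)%O by rewrite -disj_leC meetC disj_leC.
    have := sym_split (phi_ball _).1 (bsym _ leab) pq.
    by rewrite !phi_complE esplit; lra.
Qed.

Lemma phi_cone_bounds a x : cone x -> 0 <= phi a x <= e x.
Proof.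
move=> cx; have [p [q [cp cq ap aq spl]]] := cone_split a cx.
have := spl a; rewrite lexx => /(_ isT) ->.
have := spl \top%O; rewrite lex1 phi_top => /(_ isT) ->.
by rewrite ap aq cp cq; have := normr_ge0 p; have := normr_ge0 q; lra.
Qed.

Lemma phi_ge0 a x : cone x -> 0 <= phi a x.
Proof. by move=> /(phi_cone_bounds a)/andP[]. Qed.

Lemma phi_disjoint_full a b x : cone x -> (b <= ~` a)%O -> phi a x = e x ->
  phi b x = 0.
Proof.
move=> cx ba ax; have [p [q [cp cq bp bq spl]]] := cone_split b cx.
have bx := spl b; rewrite lexx in bx; rewrite bx// bp bq.
have := spl (~` a)%O; rewrite ba => /(_ isT).
have := spl \top%O; rewrite lex1 phi_top => /(_ isT).
have : phi (~` a)%O p = e p.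
  have [p0|p0] := eqVneq p 0.
    by rewrite p0 !scalar0//; [exact: eb.1|exact: (phi_ball _).1].
  apply/cone_exposedE => //; first exact: phi_ball.
  by move/phi_le : ba; apply; apply/cone_exposedE => //; exact: phi_ball.
have := phi_ge0 (~` a)%O cq; rewrite !phi_complE.
have := phi_ge0 a cp; have := phi_ge0 a cq.
have := phi_cone_bounds a cp.
have := normr_ge0 p; rewrite -cp; lra.
Qed.

(** Split x along a, then the rest along b; what remains is full on the
    complements of both, hence on their meet. *)
Lemma phi_disjoint a b x : (a `&` b = \bot)%O ->
  phi (a `|` b)%O x = phi a x + phi b x.
Proof.
move=> ab0; have leab : (a <= ~` b)%O by rewrite -disj_leC ab0.
have leba : (b <= ~` a)%O by rewrite -disj_leC meetC ab0.
pose c := (~` (a `|` b))%O.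
have ca : (c <= ~` a)%O by rewrite /c complU leIl.
have cb : (c <= ~` b)%O by rewrite /c complU leIr.
suff H : forall x, phi a x + phi b x + phi c x = e x.
  by have := H x; rewrite /c phi_complE; lra.
apply: scalar_eq_on_cone; [|exact: eb.1|].
  by move=> t u v /=; rewrite !(phi_ball _).1; ring.
move=> {}x cx; have [p [q [cp cq ap aq spl]]] := cone_split a cx.
have [r [s [cr cs br bs spl']]] := cone_split b cq.
have e1 := spl a; rewrite lexx in e1.
have e2 := spl b; rewrite leba !orbT in e2.
have e3 := spl c; rewrite ca !orbT in e3.
have e4 := spl \top%O; rewrite lex1 in e4.
have f1 := spl' a; rewrite leab !orbT in f1.
have f2 := spl' b; rewrite lexx in f2.
have f3 := spl' c; rewrite cb !orbT in f3.
have f4 := spl' \top%O; rewrite lex1 in f4.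
rewrite e1// e2// e3// f2// f3// aq bs ap br.
rewrite phi_top in e4 f4; rewrite e4// f4//.
rewrite (phi_disjoint_full cp leba ap) (phi_disjoint_full cp ca ap).
rewrite (phi_disjoint_full cr cb br).
have as0 : phi a s = 0.
  by have := f1 isT; rewrite aq; have := phi_ge0 a cr; have := phi_ge0 a cs; lra.
have -> : phi c s = e s.
  by rewrite /c complU; apply: phi_meet_full => //; rewrite phi_complE ?as0 ?bs; lra.
lra.
Qed.

Lemma phi_meetC a b x : phi b x = phi (a `&` b)%O x + phi (~` a `&` b)%O x.
Proof.
rewrite -phi_disjoint; last by rewrite meetACA meetxC meet0x.
by rewrite -meetUl joinxC meet1x.
Qed.

Lemma phi_mono a b x : cone x -> (a <= b)%O -> phi a x <= phi b x.
Proof.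
move=> cx /meet_idPl ab; rewrite (phi_meetC a b) ab lerDl; exact: phi_ge0.
Qed.

(** For x in the cone, the component p of x along a works: by additivity every
    phi b is split by p and q, as b is the join of a part below a and a part
    below its complement. *)
Lemma phi_restrict a x : exists y, forall b, phi b y = phi (a `&` b)%O x.
Proof.
have H y : cone y -> exists p, forall b, phi b p = phi (a `&` b)%O y.
  move=> cy; have [p [q [cp cq ap aq spl]]] := cone_split a cy.
  exists p => b; rewrite (phi_meetC a b p) spl ?leIl ?orbT//.
  rewrite (phi_disjoint_full cp (leIl _ _) ap).
  suff -> : phi (a `&` b)%O q = 0 by [].
  have := phi_mono cq (leIl a b); rewrite aq.
  by have := phi_ge0 (a `&` b)%O cq; lra.
have [y [z [cy cz -> _]]] := cone_decomposition x.
have [p hp] := H _ cy; have [q hq] := H _ cz.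
by exists (p - q) => b; rewrite !(scalarB (phi_ball _).1) hp hq.
Qed.

(** The elements that carry all of x form a filter.  The limit g of phi along
    this filter is a functional of the dual ball, and its component is below every
    member of the filter. *)
Lemma phi_support x : cone x -> exists a,
  phi a x = e x /\ forall b, phi b x = e x -> (a <= b)%O.
Proof.
move=> cx; pose D := [set a | phi a x = e x].
have DT : D \top%O by rewrite /D/= phi_top.
have DI a b : D a -> D b -> D (a `&` b)%O by exact: phi_meet_full.
(* The filter of sections of D, along which phi decreases on the cone. *)
pose G : set_system L := filter_from D (fun a => [set b | D b /\ (b <= a)%O]).
have GF : ProperFilter G.
  apply: filter_from_proper; last by move=> a Da; exists a.
  apply: filter_from_filter; first by exists \top%O.
  move=> a b Da Db; exists (a `&` b)%O; first exact: DI.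
  by move=> c /= [Dc]; rewrite lexI => /andP[].
have cvgc y : cone y -> cvg ((fun a => phi a y) @ G).
  move=> cy; pose r := inf [set phi a y | a in D].
  have hi : has_inf [set phi a y | a in D].
    split; first by exists (phi \top%O y), \top%O.
    by exists 0 => _ [a _ <-]; exact: phi_ge0.
  apply/cvg_ex; exists r; apply/cvgrPdist_lt => /= eps eps0.
  have [_ [a Da <-] ha] := inf_adherent eps0 hi.
  exists a => // b /= [Db ba].
  have rb : r <= phi b y by apply: ge_inf; [exact: hi.2|exists b].
  have := phi_mono cy ba; rewrite -/r in ha.
  by rewrite distrC ger0_norm ?subr_ge0//; lra.
have cvgy y : cvg ((fun a => phi a y) @ G).
  have [u [v [cu cv -> _]]] := cone_decomposition y.
  have -> : (fun a => phi a (u - v)) = (fun a => phi a u) \- (fun a => phi a v).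
    by apply/funext => a; rewrite (scalarB (phi_ball a).1).
  by apply: is_cvgB; exact: cvgc.
pose g y := lim ((fun a => phi a y) @ G).
have gb : dual_ball g.
  split=> [t u v|y].
    apply/cvg_lim => //.
    have -> : (fun a => phi a (t *: u + v)) =
        (fun a => t * phi a u) \+ (fun a => phi a v).
      by apply/funext => a; rewrite (phi_ball a).1.
    exact: (cvgD (cvgMl_tmp (a := t) (cvgy u)) (cvgy v)).
  rewrite ler_norml; apply/andP; split.
    apply: limr_ge; first exact: cvgy.
    near=> a; by rewrite lerNl; exact: (dual_ball_leN y (phi_ball a)).
  apply: limr_le; first exact: cvgy.
  near=> a; exact: (dual_ball_le y (phi_ball a)).
have [c cP] := functional_component gb.
exists c; split.
  apply/cP => //; apply: cvg_lim => //.
  apply: cvg_near_cst; exists \top%O => // b [Db _]; exact: Db.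
move=> b bx; apply/phi_le => f fc.
have [f1 fe] := fc; have [_ ef] := phi_sub_e fc.
have cf : cone f by rewrite /cone (exposed_norm (phi_ball c) fc).
split=> //.
have gf : g f = e f by apply/cP => //; rewrite fe ef.
have : g f <= phi b f.
  apply: limr_le; first exact: cvgy.
  by exists b => // b' /= [_ b'b]; exact: phi_mono.
by have := dual_ball_le f (phi_ball b); rewrite (exposed_norm (phi_ball c) fc) gf ef; lra.
Unshelve. all: by end_near. Qed.

Lemma boolean_masses_phi : boolean_masses phi.
Proof.
split.
- move=> tb; have : e = cst 0 by rewrite -phi_top tb phi_bot.
  move: e_tripotent => [[[_ +] _] _] e0; rewrite /dual_norm e0 => h.
  have : sup [set `|(cst 0 : Z -> R) x| | x in (unit_ball : set Z)] <= 0.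
    apply: ge_sup; first by exists `|(cst 0 : Z -> R) 0|, 0 => //;
      rewrite /unit_ball/= normr0.
    by move=> _ [y _ <-]; rewrite /= normr0.
  by rewrite h; lra.
- by move=> a; exact: (phi_ball a).1.
- exact: phi_disjoint.
- move=> a x; rewrite phi_complE.
  have [y [z [cy cz -> nyz]]] := cone_decomposition x.
  rewrite nyz !(scalarB (phi_ball _).1) (scalarB eb.1) -cy -cz.
  by have := phi_cone_bounds a cy; have := phi_cone_bounds a cz; lra.
- exact: hahn_decomposition.
- exact: phi_restrict.
- move=> x posx; have cx : cone x.
    rewrite /cone; have [a ax] := hahn_decomposition x.
    have := posx (~` a)%O; have := dual_ball_le x eb.
    by move: ax; rewrite phi_complE; lra.
  by rewrite phi_top; exact: phi_support.
Qed.
End Geometry.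

(** * The Stone space of a Boolean algebra *)

Section Ultrafilters.
Context {d : Order.disp_t} {L : ctbDistrLatticeType d}.
Implicit Types (a b c : L) (p F S : set L).

(** The indicator of p is a Boolean homomorphism. *)
Definition ultra p : Prop :=
  (forall a b, p (a `&` b)%O <-> p a /\ p b) /\ (forall a, p (~` a)%O <-> ~ p a).

Let proper_filter F : Prop :=
  [/\ ~ F \bot%O, (forall a b, F a -> F b -> F (a `&` b)%O) &
      forall a b, (a <= b)%O -> F a -> F b].

(** A maximal proper filter containing S is an ultrafilter.  The empty set is
    admitted in the poset so that the empty chain has an upper bound. *)
Lemma ultra_exists S : S !=set0 -> ~ S \bot%O ->
  (forall a b, S a -> S b -> S (a `&` b)%O) ->
  exists2 p, ultra p & S `<=` p.
Proof.
move=> [s0 Ss0] Sbot SI.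
pose Q F := proper_filter F /\ S `<=` F.
pose P F := F = set0 \/ Q F.
have [F0|A [PA maxA]] := @Zorn_bigcup L P.
  move=> FP tot; have [[X0 [FX0 QX0]]|nQ] := pselect (exists X, F0 X /\ Q X).
    right; split; last by move=> s Ss; exists X0 => //; exact: QX0.2.
    split.
    - move=> [X FX Xb]; case: (FP X FX) => [X00|[[+ _ _] _]]; last exact.
      by rewrite X00 in Xb.
    - move=> a b [X FX Xa] [Y FY Yb].
      have [XY|YX] := tot X Y FX FY.
        exists Y => //; case: (FP Y FY) => [Y0|[[_ YI _] _]].
          by rewrite Y0 in Yb.
        by apply: YI => //; exact: XY.
      exists X => //; case: (FP X FX) => [X00|[[_ XI _] _]].
        by rewrite X00 in Xa.
      by apply: XI => //; exact: YX.
    - move=> a b ab [X FX Xa]; exists X => //.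
      case: (FP X FX) => [X00|[[_ _ XU] _]]; first by rewrite X00 in Xa.
      exact: XU ab Xa.
  left; apply/seteqP; split=> // a [X FX Xa].
  case: (FP X FX) => [X0|QX]; first by rewrite X0 in Xa.
  by apply: nQ; exists X.
have QA : Q A.
  case: PA => // A0; exfalso.
  (* The empty set is not maximal: the filter generated by S is larger. *)
  apply: (maxA [set c | exists2 s, S s & (s <= c)%O]); last first.
    right; split; last by move=> s Ss; exists s.
    split.
    - by move=> [s Ss]; rewrite lex0 => /eqP s00; apply: Sbot; rewrite -s00.
    - move=> a b [s Ss sa] [t St tb]; exists (s `&` t)%O; first exact: SI.
      by rewrite leI2.
    - by move=> a b ab [s Ss sa]; exists s => //; exact: le_trans ab.
  rewrite A0; split=> // h.
  by have : (set0 : set L) s0 by apply: h; exists s0.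
have [[Abot AI AU] SA] := QA.
have As0 : A s0 by exact: SA.
have AT : A \top%O by apply: AU As0; exact: lex1.
exists A => //; split=> [a b|a].
  split=> [Aab|[]]; last exact: AI.
  by split; apply: AU Aab; rewrite ?leIl ?leIr.
split=> [Ana Aa|nAa].
  by apply: Abot; rewrite -(meetxC a); exact: AI.
(* The filter generated by A and a; by maximality it is A or improper. *)
pose B := [set c | exists2 f, A f & (f `&` a <= c)%O].
have AB : A `<=` B by move=> f Af; exists f => //; exact: leIl.
have Ba : B a by exists \top%O => //; exact: leIr.
have [[f Af]|Bbot] := pselect (B \bot%O).
  by rewrite lex0 disj_leC => fa; exact: AU fa Af.
exfalso; apply: (maxA B).
  by split=> // BA; apply: nAa; exact: BA.
right; split; last by move=> s /SA /AB.
split=> //.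
- move=> b c [f Af fb] [g Ag gc]; exists (f `&` g)%O; first exact: AI.
  by rewrite -(meetxx a) meetACA leI2.
- by move=> b c bc [f Af fb]; exists f => //; exact: le_trans bc.
Qed.
End Ultrafilters.

Section StoneSpace.
Context {d : Order.disp_t} {L : ctbDistrLatticeType d}.
Hypothesis L10 : (\top : L)%O <> (\bot)%O.

(** The argument makes the type inhabited, hence pointed. *)
Definition stone_of (_ : (\top : L)%O <> (\bot)%O) : Type := {p : set L | ultra p}.
Notation stone := (stone_of L10).

Lemma stone_inhabited : stone.
Proof.
apply: cid; have [||a b -> ->|p up _] := @ultra_exists _ L [set \top%O].
- by exists \top%O.
- by move=> /esym.
- exact: meetxx.
- by exists p.
Qed.

HB.instance Definition _ := gen_eqMixin stone.
HB.instance Definition _ := gen_choiceMixin stone.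
HB.instance Definition _ := isPointed.Build stone stone_inhabited.

Definition clopen (a : L) : set stone := [set p | sval p a].

Lemma clopenI a b : clopen (a `&` b)%O = clopen a `&` clopen b.
Proof. by apply/seteqP; split=> -[p [pI pC]] /= /pI. Qed.

Lemma clopenC a : clopen (~` a)%O = ~` clopen a.
Proof. by apply/seteqP; split=> -[p [pI pC]] /= /pC. Qed.

Lemma clopenU a b : clopen (a `|` b)%O = clopen a `|` clopen b.
Proof. by rewrite -[LHS]setCK -clopenC complU clopenI !clopenC setCI !setCK. Qed.

Lemma clopen0 : clopen \bot%O = set0.
Proof. by rewrite -(meetxC \top%O) clopenI clopenC setICr. Qed.

Lemma clopenT : clopen \top%O = setT.
Proof. by rewrite -(joinxC \top%O) clopenU clopenC setUCr. Qed.

(** Compactness of the Stone space: if no finite join of the b n covers a, the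
    differences generate a proper filter, and an ultrafilter above it is a point
    of a outside all the b n. *)
Lemma clopen_bigcup a (b : nat -> L) : clopen a `<=` \bigcup_n clopen (b n) ->
  exists n, (a <= \join_(i < n) b i)%O.
Proof.
move=> acov; apply: contrapT => nle.
(* The part of a that the first n terms leave uncovered. *)
pose s n := (a `&` ~` (\join_(i < n) b i))%O.
have joinS n : (\join_(i < n.+1) b i = (\join_(i < n) b i) `|` b n)%O.
  by rewrite big_ord_recr.
have joinm m n : (m <= n)%N -> (\join_(i < m) b i <= \join_(i < n) b i)%O.
  elim: n => [|n IH]; first by rewrite leqn0 => /eqP->.
  rewrite leq_eqVlt => /predU1P[->//|]; rewrite ltnS => /IH h.
  by rewrite joinS; apply: le_trans h _; exact: leUl.
have sm m n : (m <= n)%N -> (s n <= s m)%O.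
  by move=> /joinm h; rewrite leI2// leC.
have [||_ _ [m ->] [n ->]|p up sp] := @ultra_exists _ L [set c | exists n, c = s n].
- by exists (s 0), 0.
- by move=> [n /esym/eqP]; rewrite disj_leC complK => h; apply: nle; exists n.
- have [mn|nm] := leqP m n.
    by exists n; apply/meet_idPr; exact: sm.
  by exists m; apply/meet_idPl; apply: sm; exact: ltnW.
have pU c c' : (c <= c')%O -> p c -> p c'.
  by move=> /meet_idPl <- /up.1[].
have pa : p a by apply: (pU (s 0)); [exact: leIl|apply: sp; exists 0].
have [n _ /= pbn] := acov (exist _ p up) pa.
have : p (~` (b n))%O.
  apply: (pU (s n.+1)); last by apply: sp; exists n.+1.
  by apply: le_trans (leIr _ _) _; rewrite leC joinS leUr.
by move=> /up.2.
Qed.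

Lemma clopen_subset a b : clopen a `<=` clopen b -> (a <= b)%O.
Proof.
move=> ab; have [|n an] := @clopen_bigcup a (fun=> b).
  by move=> p /ab; exists 0.
by apply: le_trans an _; apply/joinsP_seq.
Qed.

Lemma clopen_inj : injective clopen.
Proof. by move=> a b ab; apply/eqP; rewrite eq_le !clopen_subset ?ab. Qed.

Definition stone_display : measure_display. Proof. exact. Qed.

Lemma clopens0 : range clopen set0.
Proof. by exists \bot%O => //; exact: clopen0. Qed.

Lemma clopensU : setU_closed (range clopen).
Proof. by move=> _ _ [a _ <-] [b _ <-]; exists (a `|` b)%O => //; exact: clopenU. Qed.

Lemma clopensC : setC_closed (range clopen).
Proof. by move=> _ [a _ <-]; exists (~` a)%O => //; exact: clopenC. Qed.

HB.instance Definition _ := isAlgebraOfSets.Build stone_display stone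
  clopens0 clopensU clopensC.

Section Premeasure.
Context {R : realType} (nu : L -> R).

(** The two unnamed arguments make the measure structure on this function
    inferable. *)
Definition premeasure_of (_ : forall a, 0 <= nu a)
  (_ : forall a b, (a `&` b = \bot)%O -> nu (a `|` b)%O = nu a + nu b)
  (A : set stone) : \bar R := (nu (xget \bot%O [set a | clopen a = A]))%:E.

Hypothesis nu_ge0 : forall a, 0 <= nu a.
Hypothesis nuU : forall a b, (a `&` b = \bot)%O -> nu (a `|` b)%O = nu a + nu b.
Notation premeasure := (premeasure_of nu_ge0 nuU).

Lemma premeasureE a : premeasure (clopen a) = (nu a)%:E.
Proof.
rewrite /premeasure_of; congr (nu _)%:E.
by apply: xget_unique => // b /clopen_inj.
Qed.

Lemma nu_bot : nu \bot%O = 0.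
Proof.
have : nu (\bot `|` \bot)%O = nu \bot%O + nu \bot%O by apply: nuU; exact: meetxx.
by rewrite joinxx; lra.
Qed.

Lemma nuD a b : nu b = nu (a `&` b)%O + nu (~` a `&` b)%O.
Proof.
rewrite -nuU; last by rewrite meetACA meetxC meet0x.
by rewrite -meetUl joinxC meet1x.
Qed.

Lemma nu_le a b : (a <= b)%O -> nu a <= nu b.
Proof. by move=> /meet_idPl ab; rewrite (nuD a b) ab lerDl. Qed.

Lemma nu_join a b : nu (a `|` b)%O <= nu a + nu b.
Proof.
rewrite (nuD a (a `|` b)%O) (meet_l (leUl a b)) lerD2l meetUr meetCx join0x.
by apply: nu_le; exact: leIr.
Qed.

Lemma nu_joins (b : nat -> L) n : nu (\join_(i < n) b i)%O <= \sum_(i < n) nu (b i).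
Proof.
elim: n => [|n IH]; first by rewrite !big_ord0 nu_bot.
by rewrite !big_ord_recr/=; apply: le_trans (nu_join _ _) _; rewrite lerD2r.
Qed.

Lemma premeasure_ge0 A : (0 <= premeasure A)%E.
Proof. by rewrite lee_fin. Qed.

Lemma premeasure_additive : measure_function.semi_additive premeasure.
Proof.
have m0 : premeasure set0 = 0%E by rewrite -clopen0 premeasureE nu_bot.
apply/(measure_function.additive2P m0) => _ _ [a _ <-] [b _ <-].
rewrite -clopenI -clopen0 => /clopen_inj ab.
by rewrite -clopenU !premeasureE nuU.
Qed.

HB.instance Definition _ := isContent.Build stone_display stone R premeasure
  premeasure_ge0 premeasure_additive.

(** By compactness a countable cover of a clopen set by clopen sets has a finite
    subcover, so countable subadditivity reduces to finite subadditivity. *)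
Lemma premeasure_sigma_subadditive : measurable_subset_sigma_subadditive premeasure.
Proof.
move=> _ F mF [a _ <-] aF.
have /choice[b bF] n : exists b, clopen b = F n by case: (mF n) => b; exists b.
have [n an] : exists n, (a <= \join_(i < n) b i)%O.
  by apply: clopen_bigcup; under eq_bigcupr do rewrite bF.
apply: (@le_trans _ _ (\sum_(0 <= i < n) premeasure (F i))%E); last first.
  by apply: nneseries_lim_ge => k _ _; exact: premeasure_ge0.
rewrite premeasureE big_mkord.
under eq_bigr do rewrite -bF premeasureE.
by rewrite sumEFin lee_fin; apply: le_trans (nu_le an) (nu_joins _ _).
Qed.

HB.instance Definition _ := Content_SigmaSubAdditive_isMeasure.Build
  stone_display R stone premeasure premeasure_sigma_subadditive.

Lemma stone_measure : exists M :
  {measure set (g_sigma_algebraType (range clopen)) -> \bar R},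
  forall a, M (clopen a) = (nu a)%:E.
Proof.
exists (measure_extension premeasure) => a.
rewrite /= /measure_extension measurable_mu_extE/= ?premeasureE//.
by exists a.
Qed.
End Premeasure.
End StoneSpace.

Lemma stone_representation (R : realType) (d : Order.disp_t)
    (L : ctbDistrLatticeType d) : (\top : L)%O <> (\bot)%O ->
  exists (d' : measure_display) (T : measurableType d') (cl : L -> set T),
  [/\ cl \top%O = setT, (forall a b, cl (a `&` b)%O = cl a `&` cl b),
      (forall a, cl (~` a)%O = ~` cl a), @measurable _ T = <<s range cl >> &
      forall nu : L -> R, (forall a, 0 <= nu a) ->
        (forall a b, (a `&` b = \bot)%O -> nu (a `|` b)%O = nu a + nu b) ->
        exists M : {measure set T -> \bar R}, forall a, M (cl a) = (nu a)%:E].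
Proof.
move=> L10; exists _, (g_sigma_algebraType (range (@clopen _ L L10))), (@clopen _ L L10).
split.
- exact: clopenT.
- exact: clopenI.
- exact: clopenC.
- by [].
- by move=> nu nu0 nuU; exact: stone_measure.
Qed.

(** * Sums of measures, and maximal elements by exhaustion *)

Section EsumMeasure.
Context {d : measure_display} {T : measurableType d} {R : realType}.
Context {I : choiceType} (D : set I) (mu : I -> {measure set T -> \bar R}).
Local Open Scope ereal_scope.

Definition esum_measure (B : set T) : \bar R := \esum_(i in D) mu i B.

Lemma esum_measure0 : esum_measure set0 = 0.
Proof. by apply: esum1 => i _; exact: measure0. Qed.

Lemma esum_measure_ge0 B : 0 <= esum_measure B.
Proof. by apply: esum_ge0 => i _; exact: measure_ge0. Qed.

Lemma esum_measure_sigma_additive : semi_sigma_additive esum_measure.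
Proof.
move=> F mF tF mUF; apply: cvg_toP.
  by apply: is_cvg_nneseries => n _ _; exact: esum_measure_ge0.
rewrite nneseries_esumT; last by move=> n; exact: esum_measure_ge0.
rewrite /esum_measure esum_esum//.
rewrite (eq_esum (b := fun i => \esum_(n in setT) mu i (F n))); last first.
  move=> i _; rewrite -nneseries_esumT//.
  by rewrite measure_semi_bigcup.
rewrite esum_esum//.
pose sw (k : I * nat) := (k.2, k.1).
rewrite (reindex_esum (D `*`` fun=> setT) ([set: nat] `*`` fun=> D) sw) //.
split=> [[i n] [/= Di _]//|[i n] [j k] _ _ [-> ->]//|[n i] [/= _ Di]].
by exists (i, n).
Qed.

HB.instance Definition _ := isMeasure.Build d T R esum_measure
  esum_measure0 esum_measure_ge0 esum_measure_sigma_additive.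
End EsumMeasure.

(** A finite sum leaves room for only finitely many terms above each 1 / (n + 1). *)
Lemma esum_finite_countable (R : realType) (I : choiceType) (D : set I)
    (a : I -> \bar R) :
  (forall i, D i -> (0 <= a i)%E) -> (\esum_(i in D) a i < +oo)%E ->
  countable [set i | D i /\ a i != 0%E].
Proof.
move=> a0 afin.
pose B n := [set i | D i /\ (n.+1%:R^-1%:E <= a i)%E].
suff finB n : finite_set (B n).
  apply: (@sub_countable _ _ _ (\bigcup_n B n)).
    apply: subset_card_le => i [Di ai].
    have {}ai : (0 < a i)%E by rewrite lt_neqAle eq_sym ai a0.
    have [e e0 eai] : exists2 e : R, 0 < e & (e%:E <= a i)%E.
      case: (a i) ai => [r r0|_|//]; first by exists r.
      by exists 1 => //; rewrite leey.
    exists (Num.truncn e^-1) => //; split=> //.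
    apply: le_trans eai; rewrite lee_fin -[leRHS]invrK lef_pV2 ?posrE ?invr_gt0//.
    by apply: ltW; exact: truncnS_gt.
  by apply: bigcup_countable => // n _; exact: finite_set_countable.
apply: contrapT => /infinite_set_fset infB.
set s := (\esum_(i in D) a i)%E in afin.
have [k sk] : exists k : nat, (s < (k%:R * n.+1%:R^-1)%:E)%E.
  have s0 : (0 <= s)%E by exact: esum_ge0.
  exists (Num.truncn (fine s * n.+1%:R)).+1.
  rewrite -[s]fineK ?ge0_fin_numE// lte_fin -ltr_pdivrMr ?invr_gt0// invrK.
  exact: truncnS_gt.
have [F FB kF] := infB k.
suff : ((k%:R * n.+1%:R^-1)%:E <= s)%E by rewrite leNgt sk.
apply: esum_ge; exists [set` F].
  by split=> // i /FB[].
rewrite fsbig_finite//= set_fsetK.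
apply: (@le_trans _ _ (\sum_(i <- F) (n.+1%:R^-1)%:E)%E); last first.
  by rewrite big_seq [leRHS]big_seq; apply: lee_sum => i /FB[].
rewrite sumEFin lee_fin big_const_seq count_predT iter_addr_0 -[leRHS]mulr_natl.
by rewrite ler_wpM2r ?invr_ge0// ler_nat.
Qed.

Section MaximalValue.
Context {R : realType} (P : Type) (rel : P -> P -> Prop) (v : P -> R) (C : R).
Hypothesis rel_refl : forall p, rel p p.
Hypothesis rel_trans : forall p q r, rel p q -> rel q r -> rel p r.
Hypothesis rel_v : forall p q, rel p q -> v p <= v q.
Hypothesis v_le : forall p, v p <= C.
Hypothesis rel_chain : forall u : nat -> P, (forall n, rel (u n) (u n.+1)) ->
  exists q, forall n, rel (u n) q.

(** Pick at each step an element that realizes at least half of the possible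
    increase of v.  An upper bound q of the resulting sequence cannot be improved:
    an improvement by 2 e was available at every step, so v would have increased
    by at least e each time. *)
Lemma maximal_value (p0 : P) : exists p, forall q, rel p q -> v q <= v p.
Proof.
have step p : exists q, rel p q /\ forall r, rel p r -> v r - v p <= 2 * (v q - v p).
  pose s := sup [set v q | q in rel p].
  have hs : has_sup [set v q | q in rel p].
    by split; [exists (v p), p|exists C => _ [q _ <-]].
  have sub r : rel p r -> v r <= s.
    by move=> pr; apply: ub_le_sup; [exact: hs.2|exists r].
  have [sp|sp] := leP s (v p).
    by exists p; split=> // r /sub; lra.
  have d0 : 0 < (s - v p) / 2 by rewrite divr_gt0// subr_gt0.
  have [_ [q pq <-] sq] := sup_adherent d0 hs.
  by exists q; split=> // r /sub; rewrite -/s in sq; lra.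
have /choice[f fP] := step.
pose u n := iter n f p0.
have uS n : rel (u n) (u n.+1) by case: (fP (u n)).
have [q uq] := rel_chain uS.
exists q => r qr; rewrite leNgt; apply/negP => vqr.
(* Each step gains at least half of what r would still gain over q. *)
pose e := (v r - v q) / 2.
have e0 : 0 < e by rewrite divr_gt0// subr_gt0.
have inc n : e <= v (u n.+1) - v (u n).
  have := (fP (u n)).2 r (rel_trans (uq n) qr); rewrite -/(u n.+1).
  by have := rel_v (uq n); rewrite /e; lra.
have grow n : v p0 + n%:R * e <= v (u n).
  elim: n => [|n IH]; first by rewrite mul0r addr0.
  by have := inc n; rewrite -natr1; lra.
have [n nC] : exists n : nat, C - v p0 < n%:R * e.
  exists (Num.truncn ((C - v p0) / e)).+1.
  by rewrite -ltr_pdivrMr//; exact: truncnS_gt.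
by have := grow n; have := v_le (u n); lra.
Qed.
End MaximalValue.

(** * Classes of integrable functions *)

Section L1Classes.
Context {d : measure_display} {T : measurableType d} {R : realType}.
Context (mu : {measure set T -> \bar R}).

Lemma L1_measurable (q : LspaceType1 mu) : measurable_fun setT (q : T -> R).
Proof. exact: (measurable_funPT (repr (LebesgueSpace.sort q))). Qed.

Lemma L1_finite (q : LspaceType1 mu) : (\int[mu]_t `|q t|%:E < +oo)%E.
Proof.
have := @Lebesgue_finite _ _ _ _ _ _ q.
by rewrite /finite_norm Lnorm1.
Qed.

Lemma L1_integrable (q : LspaceType1 mu) : mu.-integrable setT (EFin \o q).
Proof.
apply/integrableP; split; last exact: L1_finite.
by apply/measurable_EFinP; exact: L1_measurable.
Qed.

(** Two elements over the same class differ only by the proof of integrability that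
    they carry. *)
Lemma L1_ext (q r : LspaceType1 mu) : {ae mu, forall t, q t = r t} -> q = r.
Proof.
move=> qr.
have e : LebesgueSpace.sort q = LebesgueSpace.sort r.
  rewrite -(reprK (LebesgueSpace.sort q)) -(reprK (LebesgueSpace.sort r)).
  apply/eqmodP; apply/asboolP; apply: filterS qr => t /= qrt _; exact: qrt.
case: q r e {qr} => [q [[qf]]] [r [[rf]]] /= e.
by case: _ / e rf => rf; rewrite (Prop_irrelevance qf rf).
Qed.

Lemma L1_class (h : T -> R) : mu.-integrable setT (EFin \o h) ->
  exists q : LspaceType1 mu, {ae mu, forall t, q t = h t}.
Proof.
move=> ih.
have mh : measurable_fun setT h by apply/measurable_EFinP; case/integrableP: ih.
have mh' : @measurable_fun _ _ T (measurableTypeR R) setT h by exact: mh.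
pose hm : {mfun T >-> measurableTypeR R} := 
  HB.pack h (isMeasurableFun.Build _ _ T (measurableTypeR R) h mh').
pose q : {mfun_ mu, T >-> measurableTypeR R} := \pi_({mfun_ mu, T >-> measurableTypeR R})%qT hm.
have qh : {ae mu, forall t, q t = h t}.
  have /eqmodP/asboolP : (\pi_({mfun_ mu, T >-> measurableTypeR R}) (repr q) =
      \pi_({mfun_ mu, T >-> measurableTypeR R}) hm)%qT.
    by rewrite reprK.
  by apply: filterS => t /= /(_ I).
have fq : finite_norm mu 1%E (q : T -> R).
  rewrite /finite_norm Lnorm1.
  rewrite (ae_eq_integral (fun t => `|h t|%:E)%E)//.
  - by case/integrableP: ih.
  - apply/measurable_EFinP; apply: measurableT_comp => //; exact: measurable_funPT.
  - by apply/measurable_EFinP; apply: measurableT_comp.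
  - by apply: filterS qh => t /= ->.
pose Q : LspaceType1 mu := HB.pack q (isFinLebesgue.Build _ _ _ _ _ (lexx 1%E) q fq).
by exists Q.
Qed.
End L1Classes.

(** * From additive masses to integrable densities *)

Section Masses.
Context {R : realType} {Z : completeNormedModType R}.
Context {d : Order.disp_t} {L : ctbDistrLatticeType d} {m : L -> Z -> R}.
Hypothesis H : boolean_masses m.
Implicit Types (a b c : L) (x y z w : Z).

Definition pos x := forall a, 0 <= m a x.

Let mS a : scalar (m a). Proof. exact: mass_scalar. Qed.

Lemma mass_bot x : m \bot%O x = 0.
Proof.
have := mass_disjoint H x (meetxx \bot%O).
by rewrite joinxx; lra.
Qed.

Lemma mass_split a b x : m b x = m (a `&` b)%O x + m (~` a `&` b)%O x.
Proof.
rewrite -(mass_disjoint H); last by rewrite meetACA meetxC meet0x.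
by rewrite -meetUl joinxC meet1x.
Qed.

Lemma mass_compl a x : m (~` a)%O x = m \top%O x - m a x.
Proof. by rewrite (mass_split a \top%O) !meetx1; lra. Qed.

(** From 2 m a x - m top x <= |x|, applied to x and - x. *)
Lemma mass_ball a : dual_ball (m a).
Proof.
split=> // x; rewrite ler_norml.
have h y b : 2 * m b y - m \top%O y <= `|y|.
  by have := mass_le_norm H b y; rewrite mass_compl; lra.
have := h x a; have := h x \top%O; have := h x \bot%O; rewrite mass_bot.
have := h (- x) a; have := h (- x) \top%O.
by rewrite normrN !(scalarN (mS _)); lra.
Qed.

Lemma mass_mono a b x : pos x -> (a <= b)%O -> m a x <= m b x.
Proof. by move=> px /meet_idPl ab; rewrite (mass_split a b) ab lerDl; exact: px. Qed.

Lemma pos_norm x : pos x -> `|x| = m \top%O x.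
Proof.
move=> px; have [a ax] := mass_norm H x.
have := px (~` a)%O; have := dual_ball_le x (mass_ball \top%O).
by move: ax; rewrite mass_compl; lra.
Qed.

Lemma mass_ext x y : (forall a, m a x = m a y) -> x = y.
Proof.
move=> xy; apply/eqP; rewrite -subr_eq0 -normr_le0.
have [a ->] := mass_norm H (x - y).
by rewrite !(scalarB (mS _)) !xy; lra.
Qed.

Lemma pos0 : pos 0.
Proof. by move=> a; rewrite scalar0. Qed.

Lemma posD x y : pos x -> pos y -> pos (x + y).
Proof. by move=> px py a; rewrite (scalarD (mS _)) addr_ge0. Qed.

Lemma posZ (t : R) x : 0 <= t -> pos x -> pos (t *: x).
Proof. by move=> t0 px a; rewrite (scalarZ (mS _)) mulr_ge0. Qed.

Lemma pos_eq0 x : pos x -> m \top%O x <= 0 -> x = 0.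
Proof. by move=> px; rewrite -pos_norm// normr_le0 => /eqP. Qed.

Definition restriction a x : Z := sval (cid (mass_restrict H a x)).

Lemma mass_restriction a x b : m b (restriction a x) = m (a `&` b)%O x.
Proof. by rewrite /restriction; case: cid. Qed.

Lemma pos_restriction a x : pos x -> pos (restriction a x).
Proof. by move=> px b; rewrite mass_restriction. Qed.

(** If the norm is attained at a, moving a part b below a to the complement can
    only decrease m a x, so m b x >= 0, and symmetrically outside a. *)
Lemma hahn_component x : exists a,
  pos (restriction a x) /\ pos (- restriction (~` a)%O x).
Proof.
have [a ax] := mass_norm H x; exists a.
have maxa b : 2 * m b x <= 2 * m a x.
  have := mass_le_norm H b x; rewrite ax !mass_compl; lra.
split=> b; rewrite ?(scalarN (mS _)) mass_restriction.
  have := maxa (~` b `&` a)%O; have := mass_split b a x.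
  by rewrite (meetC b); lra.
have := maxa (a `|` (~` a `&` b))%O.
rewrite (mass_disjoint H); first by lra.
by rewrite meetA meetxC meet0x.
Qed.

(** For increasing sequences of nonnegative elements the norm of a difference is
    a difference of total masses, so bounded ones are Cauchy. *)
Lemma pos_limit (u : nat -> Z) (C : R) :
  (forall n, pos (u n.+1 - u n)) -> (forall n, m \top%O (u n) <= C) ->
  exists y, (forall a, m a (u n) @[n --> \oo] --> m a y) /\
            (forall n, pos (y - u n)).
Proof.
move=> upos uC; pose t n := m \top%O (u n).
have uge n k : pos (u (n + k)%N - u n).
  elim: k => [|k IH]; first by rewrite addn0 subrr; exact: pos0.
  have -> : u (n + k.+1)%N - u n =
      (u (n + k).+1 - u (n + k)%N) + (u (n + k)%N - u n).
    by rewrite addnS addrA subrK.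
  by apply: posD.
have ule n k : (n <= k)%N -> pos (u k - u n).
  by move=> nk; rewrite -(subnKC nk).
have dist n k : `|u n - u k| = `|t n - t k|.
  (* u is increasing, so distances are differences of total masses. *)
  wlog nk : n k / (n <= k)%N.
    by move=> h; have [/h//|/ltnW/h] := leqP n k; rewrite distrC => ->; rewrite distrC.
  rewrite distrC (pos_norm (ule _ _ nk)) distrC (scalarB (mS _)) ger0_norm//.
  by have := ule _ _ nk \top%O; rewrite scalarB.
have tcvg : cvg (t @ \oo).
  apply: nondecreasing_is_cvgn; last by exists C => _ [n _ <-]; exact: uC.
  by move=> n k nk; rewrite -subr_ge0 /t -(scalarB (mS _)); exact: ule.
have ucvg : cvg (u @ \oo).
  apply/cauchy_cvgP; apply: (iffLR (cauchy_ballP _)) => eps eps0.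
  have /(_ _ eps0) : cauchy_ball (t @ \oo).
    by apply: (iffRL (cauchy_ballP _)); exact: cvg_cauchy.
  rewrite !near_map2; apply: filterS => -[n k] /=.
  by rewrite -!ball_normE /= dist.
exists (lim (u @ \oo)).
have lima a : m a (u n) @[n --> \oo] --> m a (lim (u @ \oo)).
  by apply: continuous_cvg; [exact: (dual_ball_continuous (mass_ball a))|exact: ucvg].
split=> // n a; rewrite (scalarB (mS _)) subr_ge0.
rewrite -(cvg_lim _ (lima a))//; apply: limr_ge.
  by apply/cvg_ex; exists (m a (lim (u @ \oo))); exact: lima.
near=> k.
have := ule n k _ a; rewrite (scalarB (mS _)) subr_ge0; apply.
by near: k; exact: nbhs_infty_ge.
Unshelve. all: by end_near. Qed.

Definition is_support a x : Prop :=
  [/\ pos x, m a x = m \top%O x & forall b, m b x = m \top%O x -> (a <= b)%O].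

Lemma support_mass_gt0 a x : is_support a x -> a <> \bot%O -> 0 < m \top%O x.
Proof.
move=> [px ax amin] a0; rewrite lt_neqAle px andbT; apply/eqP => x0.
by apply: a0; apply/eqP; rewrite -lex0; apply: amin; rewrite mass_bot.
Qed.

(** An element with no mass on any a in D has a support disjoint from all of
    them, which could be added to D. *)
Lemma maximal_supports : exists (D : set L) (X : L -> Z),
  [/\ forall a, D a -> a <> \bot%O /\ is_support a (X a),
      forall a b, D a -> D b -> a <> b -> (a `&` b = \bot)%O &
      forall w, pos w -> (forall a, D a -> m a w = 0) -> w = 0].
Proof.
pose Q (A : set L) := (forall a, A a -> a <> \bot%O /\ exists x, is_support a x) /\
  (forall a b, A a -> A b -> a <> b -> (a `&` b = \bot)%O).
have [F FQ tot|D [[Dsupp Ddisj] maxD]] := @Zorn_bigcup L Q.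
  split=> [a [A FA Aa]|a b [A FA Aa] [B FB Bb] ab].
    by case: (FQ A FA) => + _; exact.
  have [AB|BA] := tot A B FA FB.
    by case: (FQ B FB) => _; apply=> //; exact: AB.
  by case: (FQ A FA) => _; apply=> //; exact: BA.
have /choice[X XP] a : exists x, D a -> is_support a x.
  have [/Dsupp[_ [x xP]]|nDa] := pselect (D a); first by exists x.
  by exists 0.
exists D, X; split=> // [a Da|w pw wD]; first by split; [case: (Dsupp a Da)|exact: XP].
apply: contrapT => w0.
have [b [bw bmin]] := mass_support H pw.
have b0 : b <> \bot%O.
  by move=> b0; apply: w0; apply: pos_eq0 => //; rewrite -bw b0 mass_bot.
have bD a : D a -> (b <= ~` a)%O.
  by move=> Da; apply: bmin; rewrite mass_compl (wD a Da) subr0.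
have nDb : ~ D b.
  move=> Db; apply: b0; apply/eqP; rewrite -(meetxx b).
  by rewrite disj_leC; exact: bD.
apply: (maxD (D `|` [set b])).
  by split=> [a Da|DbD]; [left|apply: nDb; apply: DbD; right].
have disjb a : D a -> (a `&` b = \bot)%O.
  by move=> Da; apply/eqP; rewrite meetC disj_leC; exact: bD.
split=> [a [/Dsupp//|->]|a c [Da|->] [Dc|->] ac //].
- by split=> //; exists w.
- exact: Ddisj.
- exact: disjb.
- by rewrite meetC; exact: disjb.
Qed.

Section Measures.
Context {dT : measure_display} {T : measurableType dT} {cl : L -> set T}.
Hypothesis clT : cl \top%O = setT.
Hypothesis clI : forall a b, cl (a `&` b)%O = cl a `&` cl b.
Hypothesis clC : forall a, cl (~` a)%O = ~` cl a.
Hypothesis clM : @measurable _ T = <<s range cl >>.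
Hypothesis clE : forall nu : L -> R, (forall a, 0 <= nu a) ->
  (forall a b, (a `&` b = \bot)%O -> nu (a `|` b)%O = nu a + nu b) ->
  exists M : {measure set T -> \bar R}, forall a, M (cl a) = (nu a)%:E.
Implicit Types (B : set T).

Lemma measurable_cl a : measurable (cl a).
Proof. by rewrite clM; apply: sub_sigma_algebra; exists a. Qed.

Lemma setI_closed_cl : setI_closed (range cl).
Proof. by move=> _ _ [a _ <-] [b _ <-]; exists (a `&` b)%O. Qed.

(** Elements that are not nonnegative receive the zero measure, a junk value. *)
Definition measure_of y : {measure set T -> \bar R} :=
  if pselect (pos y) is left py then
    sval (cid (clE py (fun a b => @mass_disjoint _ _ _ _ _ H a b y)))
  else mzero.

Lemma measure_of_cl y a : pos y -> measure_of y (cl a) = (m a y)%:E.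
Proof. by rewrite /measure_of => py; case: pselect => // {}py; case: cid. Qed.

Lemma measure_of_setT y : pos y -> measure_of y setT = (m \top%O y)%:E.
Proof. by move=> py; rewrite -clT measure_of_cl. Qed.

Lemma measure_of_le_setT y B : pos y -> measurable B ->
  (measure_of y B <= (m \top%O y)%:E)%E.
Proof. by move=> py mB; rewrite -measure_of_setT// le_measure// inE. Qed.

Lemma measure_of_fin y B : pos y -> measurable B -> measure_of y B \is a fin_num.
Proof.
move=> py mB; rewrite ge0_fin_numE//.
by apply: le_lt_trans (measure_of_le_setT py mB) _; rewrite ltry.
Qed.

Lemma measure_of_unique (mu1 mu2 : {measure set T -> \bar R}) :
  (forall a, mu1 (cl a) = mu2 (cl a)) -> (mu1 setT < +oo)%E ->
  forall B, measurable B -> mu1 B = mu2 B.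
Proof.
move=> mu12 mu1T.
apply: (@measure_unique _ _ _ (range cl) (fun=> cl \top%O) clM setI_closed_cl).
- by move=> _; exists \top%O.
- by rewrite clT bigcup_const.
- by move=> _ [a _ <-].
- by move=> _; rewrite clT.
Qed.

Lemma measure_of_unique_mass y (mu : {measure set T -> \bar R}) : pos y ->
  (forall a, mu (cl a) = (m a y)%:E) ->
  forall B, measurable B -> measure_of y B = mu B.
Proof.
move=> py mucl; apply: measure_of_unique => [a|]; first by rewrite measure_of_cl.
by rewrite measure_of_setT// ltry.
Qed.

Lemma measure_ofD y z B : pos y -> pos z -> measurable B ->
  measure_of (y + z) B = (measure_of y B + measure_of z B)%E.
Proof.
move=> py pz mB; rewrite -measure_addE.
apply: (@measure_of_unique_mass _ (measure_add (measure_of y) (measure_of z))) => // [|a].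
  exact: posD.
by rewrite [LHS]measure_addE !measure_of_cl// (scalarD (mS _)).
Qed.

Lemma measure_ofZ (t : R) y B : 0 <= t -> pos y -> measurable B ->
  measure_of (t *: y) B = (t%:E * measure_of y B)%E.
Proof.
move=> t0 py mB.
apply: (@measure_of_unique_mass _ (mscale (NngNum t0) (measure_of y))) => // [|a].
  exact: posZ.
by rewrite /= /mscale /= measure_of_cl// (scalarZ (mS _)).
Qed.

Lemma measure_of_restriction a y B : pos y -> measurable B ->
  measure_of (restriction a y) B = measure_of y (B `&` cl a).
Proof.
move=> py mB.
apply: (@measure_of_unique_mass _ (mrestr (measure_of y) (measurable_cl a))) => // [|b].
  exact: pos_restriction.
by rewrite /= /mrestr -clI measure_of_cl// mass_restriction meetC.
Qed.

Lemma measure_ofB x y B : pos x -> pos (y - x) -> measurable B ->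
  measure_of y B = (measure_of x B + measure_of (y - x)%R B)%E.
Proof. by move=> px pyx mB; rewrite -measure_ofD// addrC subrK. Qed.

Lemma measure_of_le x y B : pos x -> pos (y - x) -> measurable B ->
  (measure_of x B <= measure_of y B)%E.
Proof. by move=> px pyx mB; rewrite (measure_ofB px pyx mB) leeDl. Qed.

Lemma measure_of_pos x y : pos x -> pos y ->
  (forall B, measurable B -> (measure_of x B <= measure_of y B)%E) -> pos (y - x).
Proof.
move=> px py xy a; rewrite (scalarB (mS _)) subr_ge0 -lee_fin -!measure_of_cl//.
exact/xy/measurable_cl.
Qed.

Lemma measure_of_limit (u : nat -> Z) y B : (forall n, pos (u n)) ->
  (forall n, pos (y - u n)) -> m \top%O (u n) @[n --> \oo] --> m \top%O y ->
  measurable B -> measure_of (u n) B @[n --> \oo] --> measure_of y B.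
Proof.
move=> pu pyu uy mB.
have py : pos y by rewrite -(subrK (u 0) y); apply: posD.
have yu n : measure_of (u n) B = (measure_of y B - measure_of (y - u n)%R B)%E.
  by rewrite (measure_ofB (pu n) (pyu n) mB) addeK// measure_of_fin.
have lim0 : measure_of (y - u n) B @[n --> \oo] --> 0%E.
  apply: (@squeeze_cvge _ _ _ _ (cst 0%E) _
    (fun n => (m \top%O y - m \top%O (u n))%:E)).
  - by near=> n; rewrite /= measure_ge0 -(scalarB (mS _)) measure_of_le_setT.
  - exact: cvg_cst.
  - apply: cvg_EFin; first by near=> n.
    have h : (m \top%O y - m \top%O (u n)) @[n --> \oo] --> m \top%O y - m \top%O y.
      by apply: cvgB; [exact: cvg_cst|exact: uy].
    by rewrite subrr in h.
rewrite -[X in _ --> X]adde0 -oppe0.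
have -> : (fun n => measure_of (u n) B) =
    (fun n => measure_of y B - measure_of (y - u n)%R B)%E.
  exact/funext.
by apply: cvgeB; [rewrite fin_num_adde_defl// measure_of_fin|exact: cvg_cst|].
Unshelve. all: by end_near. Qed.

(** The sets B for which all restrictions to B exist form a Dynkin system
    containing the clopen sets: complements come from differences, disjoint unions
    from limits of increasing sums. *)
Lemma measure_of_restrict B : measurable B -> forall y, pos y ->
  exists z, pos z /\ forall B', measurable B' -> measure_of z B' = measure_of y (B `&` B').
Proof.
move=> mB.
pose P B := forall y, pos y ->
  exists z, pos z /\ forall B', measurable B' -> measure_of z B' = measure_of y (B `&` B').
have mBs := mB; rewrite clM in mBs; move: B mBs {mB}.
apply: (dynkin_induction (G := range cl) (P := P) clM setI_closed_cl).
- by move=> y py; exists y; split=> // B' mB'; rewrite setTI.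
- move=> _ [a _ <-] y py; exists (restriction a y); split; first exact: pos_restriction.
  by move=> B' mB'; rewrite measure_of_restriction// setIC.
- move=> B mB PB y py; have [z [pz zE]] := PB y py.
  have pyz : pos (y - z).
    apply: measure_of_pos => // B' mB'; rewrite zE// le_measure// ?inE//.
    exact: measurableI.
  exists (y - z); split=> // B' mB'.
  have := measure_ofB pz pyz mB'; rewrite zE// => e.
  have mBB : measurable (B `&` B') by exact: measurableI.
  have mCB : measurable (~` B `&` B') by apply: measurableI => //; exact: measurableC.
  have : measure_of y B' = (measure_of y (B `&` B') + measure_of y (~` B `&` B'))%E.
    rewrite -measureU//; last by rewrite setIACA setICr set0I.
    by rewrite -setIUl setUv setTI.
  rewrite e => eq2; have f := measure_of_fin py mBB.
  rewrite -[LHS](addeK _ f) [X in (X - _)%E]addeC eq2.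
  by rewrite [X in (X - _)%E]addeC addeK.
- move=> F mF tF PF y py.
  have /choice[z zP] n : exists z, pos z /\
      forall B', measurable B' -> measure_of z B' = measure_of y (F n `&` B') by exact: PF.
  have pz n : pos (z n) by case: (zP n).
  have zE n B' : measurable B' -> measure_of (z n) B' = measure_of y (F n `&` B').
    by case: (zP n) => _; exact.
  pose u n := \sum_(i < n) z i.
  have uS n : u n.+1 - u n = z n by rewrite /u big_ord_recr /= [X in X - _]addrC addrK.
  have pu n : pos (u n).
    elim: n => [|n IH]; first by rewrite /u big_ord0; exact: pos0.
    by rewrite -(subrK (u n) (u n.+1)) uS; exact: posD.
  have uM n B' : measurable B' ->
      measure_of (u n) B' = (\sum_(0 <= i < n) measure_of y (F i `&` B'))%E.
    move=> mB'; elim: n => [|n IH].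
      rewrite /u big_ord0 big_geq// -(scale0r y) measure_ofZ// mul0e//.
    rewrite big_nat_recr//= -IH -zE// -measure_ofD// -uS addrC subrK //.
  have tFB B' : trivIset setT (fun i => F i `&` B').
    exact: trivIset_setIr.
  have [||w [wu pwu]] := pos_limit (u := u) (C := m \top%O y).
  - by move=> n; rewrite uS.
  - move=> n; rewrite -lee_fin -measure_of_setT// -measure_of_setT// uM//.
    under eq_bigr do rewrite setIT.
    rewrite big_mkord -measure_bigsetU//; apply: le_measure => //; rewrite inE//.
    exact: bigsetU_measurable.
  have pw : pos w by rewrite -(subrK (u 0) w); apply: posD.
  exists w; split=> // B' mB'.
  have := measure_of_limit pu pwu (wu _) mB'.
  move=> /cvg_lim <- //; apply/cvg_lim => //.
  have -> : (fun n => measure_of (u n) B') =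
      (fun n => \sum_(0 <= i < n) measure_of y (F i `&` B'))%E.
    by apply/funext => n; rewrite uM.
  rewrite setI_bigcupl; apply: measure_semi_sigma_additive => //.
  - by move=> i; exact: measurableI.
  - by apply: bigcup_measurable => i _; exact: measurableI.
Qed.

Context {D : set L} {X : L -> Z}.
Hypothesis DX : forall a, D a -> a <> \bot%O /\ is_support a (X a).
Hypothesis Ddisj : forall a b, D a -> D b -> a <> b -> (a `&` b = \bot)%O.
Hypothesis Dmax : forall w, pos w -> (forall a, D a -> m a w = 0) -> w = 0.

Notation mu := (esum_measure D (fun a => measure_of (X a)) : {measure set T -> \bar R}).

Lemma cl_disj a b : (a `&` b = \bot)%O -> cl a `&` cl b = set0.
Proof. by rewrite -clI => ->; rewrite -(meetxC \top%O) clI clC setICr. Qed.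

Lemma pos_X a : D a -> pos (X a).
Proof. by move=> /DX[_ []]. Qed.

Lemma measure_of_X_null a B : D a -> measurable B -> B `&` cl a = set0 ->
  measure_of (X a) B = 0%E.
Proof.
move=> Da mB Ba; have [_ [px ax _]] := DX Da.
apply/eqP; rewrite eq_le measure_ge0 andbT.
have <- : measure_of (X a) (cl (~` a)%O) = 0%E.
  by rewrite measure_of_cl// mass_compl ax subrr.
apply: le_measure; rewrite ?inE//; first exact: measurable_cl.
by rewrite clC; apply/disjoints_subset.
Qed.

(** X a lives on its support. *)
Lemma measure_of_X_cl a B : D a -> measurable B ->
  measure_of (X a) (B `&` cl a) = measure_of (X a) B.
Proof.
move=> Da mB; have mBa : measurable (B `&` cl a).
  by apply: measurableI => //; exact: measurable_cl.
have mBD : measurable (B `\` cl a).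
  by apply: measurableD => //; exact: measurable_cl.
rewrite -[in RHS](setUIDK B (cl a)) measureU//; last first.
  by rewrite setDE setIACA setICr setI0.
rewrite [Y in (_ + Y)%E](measure_of_X_null Da mBD) ?adde0//.
by rewrite setDE -setIA setICl setI0.
Qed.

(** On the clopen set of a the sum mu has a single nonzero term, as the supports
    are disjoint. *)
Lemma mu_cl a B : D a -> measurable B -> mu (B `&` cl a) = measure_of (X a) B.
Proof.
move=> Da mB; rewrite /= /esum_measure (esumID [set a])//.
have -> : D `&` [set a] = [set a] by apply/setIidPr => _ ->.
rewrite esum_set1// measure_of_X_cl// esum1 ?adde0// => b [Db ba].
apply: measure_of_X_null => //.
  by apply: measurableI => //; exact: measurable_cl.
by rewrite -setIA cl_disj ?setI0//; apply: Ddisj => // ab; apply: ba.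
Qed.

Lemma mu_null B : (forall a, D a -> measure_of (X a) B = 0%E) -> mu B = 0%E.
Proof. by move=> B0; rewrite /= /esum_measure esum1. Qed.

(** A set of finite measure is charged by countably many of the measures whose
    sum is mu; the part of it outside their supports is null for all of them. *)
Lemma direct_sum_property_mu : direct_sum_property mu.
Proof.
pose A a := [set t | D a /\ cl a t].
have A1 a : D a -> A a = cl a.
  by move=> Da; apply/seteqP; split=> t; [case|split].
have A0 a : ~ D a -> A a = set0.
  by move=> nDa; apply/seteqP; split=> t // [].
exists L, A; split.
- move=> a b _ _ [t [[Da at_] [Db bt]]]; apply: contrapT => ab.
  have : (cl a `&` cl b) t by split.
  by rewrite cl_disj//; exact: Ddisj.
- move=> a; have [Da|nDa] := pselect (D a); last first.
    by rewrite A0// measure0; split=> //; exact: ltry.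
  rewrite A1//; split; first exact: measurable_cl.
  rewrite -[cl a]setTI mu_cl//.
  by rewrite measure_of_setT ?ltry//; exact: pos_X.
move=> B mB Bfin.
pose J := [set a | D a /\ measure_of (X a) B != 0%E].
have cJ : countable J by apply: esum_finite_countable.
pose N := B `\` \bigcup_(j in J) cl j.
have mN : measurable N.
  apply: measurableD => //; have /pfcard_geP[->|[g]] := cJ.
    by rewrite bigcup_set0; exact: measurable0.
  rewrite -(image_eq g) bigcup_image; apply: bigcup_measurable => n _.
  exact: measurable_cl.
exists J, N; split=> //.
  apply: mu_null => a Da; have [aJ|naJ] := pselect (J a).
    apply: measure_of_X_null => //; apply/disjoints_subset => t [_ nt] at_.
    by apply: nt; exists a.
  have MB0 : measure_of (X a) B = 0%E by apply: contrapT => /eqP h; apply: naJ.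
  apply/eqP; rewrite eq_le measure_ge0 andbT -MB0 le_measure ?inE//.
  exact: subDsetl.
apply/seteqP; split=> t.
  move=> Bt; have [[j Jj jt]|nt] := pselect ((\bigcup_(j in J) cl j) t).
    by left; exists j => //; split=> //; split=> //; case: Jj.
  by right.
by move=> [[j _ []]|[]].
Qed.

(** The measure of y is f times mu.  Infinite values of f are allowed so that
    monotone limits need no care. *)
Definition density y (f : T -> \bar R) : Prop :=
  [/\ pos y, measurable_fun setT f, (forall t, 0 <= f t)%E &
      forall B, measurable B -> measure_of y B = (\int[mu]_(t in B) f t)%E].

Lemma density0 : density 0 (cst 0%E).
Proof.
split=> //; first exact: pos0.
move=> B mB; rewrite integral0 -(scale0r (0 : Z)) measure_ofZ//; last exact: pos0.
by rewrite mul0e.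
Qed.

Lemma densityD y z f g : density y f -> density z g ->
  density (y + z) (fun t => f t + g t)%E.
Proof.
move=> [py mf f0 yf] [pz mg g0 zg]; split.
- exact: posD.
- exact: emeasurable_funD.
- by move=> t; rewrite adde_ge0.
- move=> B mB; rewrite measure_ofD// yf// zg// ge0_integralD//.
  + exact: measurable_funS mf.
  + exact: measurable_funS mg.
Qed.

(** Multiples of restrictions of X a: these are the pieces from which all
    other elements with a density are assembled. *)
Lemma density_piece a B (t : R) : D a -> measurable B -> 0 <= t ->
  exists z, density z (fun s => (t * \1_(B `&` cl a) s)%:E) /\
    forall B', measurable B' -> measure_of z B' = (t%:E * measure_of (X a) (B `&` B'))%E.
Proof.
move=> Da mB t0.
have [z [pz zE]] := measure_of_restrict mB (pos_X Da).
have zE' B' : measurable B' -> measure_of (t *: z) B' = (t%:E * measure_of (X a) (B `&` B'))%E.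
  by move=> mB'; rewrite measure_ofZ// zE.
have mBa : measurable (B `&` cl a).
  by apply: measurableI => //; exact: measurable_cl.
exists (t *: z); split=> //; split=> //; first exact: posZ.
- by apply/measurable_EFinP; apply: measurable_funM => //.
- by move=> s; rewrite lee_fin mulr_ge0.
move=> B' mB'; rewrite zE'//.
under eq_integral do rewrite EFinM.
rewrite ge0_integralZl_EFin//.
- rewrite integral_indic// setIAC mu_cl//; exact: measurableI.
- by apply/measurable_EFinP; apply: measurable_funTS.
Qed.

(** Monotone convergence on the side of the functions, completeness of Z on the
    side of the elements. *)
Lemma density_limit (u : nat -> Z) (f : nat -> T -> \bar R) (C : R) :
  (forall n, density (u n) (f n)) ->
  (forall n t, f n t <= f n.+1 t)%E -> (forall n, m \top%O (u n) <= C) ->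
  exists y, [/\ density y (fun t => limn (f ^~ t)), forall n, pos (y - u n),
    forall a, m a (u n) @[n --> \oo] --> m a y &
    forall n t, (f n t <= limn (f ^~ t))%E].
Proof.
move=> uf fS uC.
have pu n : pos (u n) by case: (uf n).
have mf n : measurable_fun setT (f n) by case: (uf n).
have f0 n t : (0 <= f n t)%E by case: (uf n).
have fmono t : {homo f ^~ t : n k / (n <= k)%N >-> (n <= k)%E}.
  by apply/nondecreasing_seqP => n; exact: fS.
have fcvg t : cvgn (f ^~ t) by apply: ereal_nondecreasing_is_cvgn; exact: fmono.
have fle n t : (f n t <= limn (f ^~ t))%E.
  by apply: lime_ge => //; near=> k; apply: fmono; near: k; exact: nbhs_infty_ge.
have [||y [uy pyu]] := pos_limit (u := u) (C := C) => //.
  move=> n; apply: measure_of_pos => // B mB.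
  have [_ _ _ ->//] := uf n; have [_ _ _ ->//] := uf n.+1.
  apply: ge0_le_integral => //.
  - exact: measurable_funS (mf n).
  - exact: measurable_funS (mf n.+1).
have py : pos y by rewrite -(subrK (u 0) y); apply: posD.
exists y; split=> //; split=> //.
- by apply: (emeasurable_fun_cvg f).
- by move=> t; apply: le_trans (f0 0 t) (fle 0 t).
move=> B mB.
have /cvg_lim <- // := measure_of_limit pu pyu (uy _) mB.
apply/cvg_lim => //.
have -> : (fun n => measure_of (u n) B) = (fun n => \int[mu]_(t in B) f n t)%E.
  by apply/funext => n; have [_ _ _ ->] := uf n.
apply: cvg_monotone_convergence => //.
  by move=> n; apply: measurable_funS (mf n).
Unshelve. all: by end_near. Qed.

(** A maximal z <= y with a density exhausts y.  Otherwise w = y - z has mass on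
    some support a.  Let e X a have half of that mass, and let c be a Hahn set of
    the restriction of w to a minus e X a.  Then m c (X a) > 0, since otherwise c
    would miss a and this difference would be negative; the restriction of e X a
    to c is below w, and z can be enlarged by it. *)
Lemma density_exists y : pos y -> exists f, density y f.
Proof.
move=> py.
pose P := {p : Z * (T -> \bar R) | density p.1 p.2 /\ pos (y - p.1)}.
pose rel (p q : P) := pos ((sval q).1 - (sval p).1) /\
  forall t, ((sval p).2 t <= (sval q).2 t)%E.
pose v (p : P) := m \top%O (sval p).1.
have P0 : P by exists (0, cst 0%E); rewrite subr0; split=> //; exact: density0.
have [|||||[[z g] /= [zg pyz]] maxz] :=
    @maximal_value R P rel v (m \top%O y) _ _ _ _ _ P0.
- by move=> p; split=> //; rewrite subrr; exact: pos0.
- move=> p q r [pq fpq] [qr fqr]; split=> [|t]; last exact: le_trans (fqr t).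
  by rewrite -(subrK (sval q).1 (sval r).1) -addrA; exact: posD.
- by move=> p q [/(_ \top%O) + _]; rewrite (scalarB (mS _)) subr_ge0.
- move=> [p [pf pyp]]; rewrite /v /=.
  by have := pyp \top%O; rewrite (scalarB (mS _)) subr_ge0.
- move=> u urel.
  have [||z [zf pz zu zle]] := @density_limit (fun n => (sval (u n)).1)
    (fun n => (sval (u n)).2) (m \top%O y) (fun n => (svalP (u n)).1).
  + by move=> n t; case: (urel n).
  + move=> n; have [_ /(_ \top%O)] := svalP (u n).
    by rewrite (scalarB (mS _)) subr_ge0.
  have pyz : pos (y - z).
    move=> a; rewrite (scalarB (mS _)) subr_ge0 -(cvg_lim _ (zu a))//.
    apply: limr_le; first by apply/cvg_ex; exists (m a z); exact: zu.
    near=> n; have [_ /(_ a)] := svalP (u n).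
    by rewrite (scalarB (mS _)) subr_ge0.
  by exists (exist _ (z, _) (conj zf pyz)) => n; split=> /=.
suff -> : y = z by exists g.
apply/eqP; rewrite -subr_eq0; apply/eqP; apply: Dmax => // a Da.
pose w := y - z; have pw : pos w := pyz.
rewrite -/w; apply/eqP/negPn/negP => aw0.
have aw : 0 < m a w by rewrite lt_neqAle eq_sym aw0 pw.
have [a0 [px ax amin]] := DX Da; set x := X a in px ax amin.
have x0 : 0 < m \top%O x by exact: support_mass_gt0 (And3 px ax amin) a0.
pose w1 := restriction a w.
have w1T : m \top%O w1 = m a w by rewrite mass_restriction meetx1.
pose e := m a w / (2 * m \top%O x).
have e0 : 0 < e by rewrite divr_gt0// mulr_gt0.
have eT : e * m \top%O x = m a w / 2.
  by rewrite /e; field; rewrite gt_eqF.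
have [c [cpos cneg]] := hahn_component (w1 - e *: x).
have cx : 0 < m c x.
  rewrite lt_neqAle px andbT; apply/eqP => cx0.
  have ac : (a <= ~` c)%O by apply: amin; rewrite mass_compl -cx0 subr0.
  have cw1 : m c w1 = 0.
    rewrite mass_restriction; have /eqP -> : (a `&` c == \bot)%O by rewrite disj_leC.
    exact: mass_bot.
  have := cneg \top%O; rewrite (scalarN (mS _)) mass_restriction meetx1 mass_compl.
  by rewrite !(scalarB (mS _)) !(scalarZ (mS _)) w1T cw1 -cx0 eT; lra.
have [z1 [z1g z1E]] := density_piece Da (measurable_cl c) (ltW e0).
have pz1 : pos z1 by case: z1g.
have z1m b : m b z1 = e * m (c `&` b)%O x.
  apply: EFin_inj; rewrite -measure_of_cl// z1E; last exact: measurable_cl.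
  by rewrite -clI measure_of_cl.
have pyzz : pos (y - (z + z1)).
  move=> b; rewrite opprD addrA -/w (scalarB (mS _)) z1m subr_ge0.
  have := cpos b; rewrite mass_restriction (scalarB (mS _)) (scalarZ (mS _)) mass_restriction.
  have : m (a `&` (c `&` b))%O w <= m b w.
    by apply: mass_mono => //; apply: le_trans (leIr _ _) (leIr _ _).
  by lra.
have zz1 := densityD zg z1g.
have := maxz (exist _ (z + z1, _) (conj zz1 pyzz)) _.
rewrite /v/= (scalarD (mS _)) z1m meetx1 => h.
have : m \top%O z + e * m c x <= m \top%O z.
  apply: h; split=> [|t] /=; first by rewrite addrC addKr.
  by rewrite leeDl//; case: z1g.
by rewrite gerDl leNgt mulr_gt0.
Unshelve. all: by end_near. Qed.

(** A maximal pair of an element z and a density g <= f of it has g = f almost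
    everywhere: otherwise some set where g + 1 / (n + 1) <= f is charged by some
    X a, and the restriction of X a / (n + 1) to this set can be added to z. *)
Lemma density_of_fun (f : T -> R) : measurable_fun setT f ->
  (forall t, 0 <= f t) -> (\int[mu]_t (f t)%:E < +oo)%E ->
  exists y, density y (EFin \o f).
Proof.
move=> mf f0 fint.
pose P := {p : Z * (T -> \bar R) |
  density p.1 p.2 /\ forall t, (p.2 t <= (f t)%:E)%E}.
pose rel (p q : P) := pos ((sval q).1 - (sval p).1) /\
  forall t, ((sval p).2 t <= (sval q).2 t)%E.
pose v (p : P) := m \top%O (sval p).1.
have P0 : P.
  by exists (0, cst 0%E); split=> [|t] /=; [exact: density0|rewrite lee_fin].
have vle p : v p <= fine (\int[mu]_t (f t)%:E)%E.
  move: p => [[p g] /= [[pp mg g0 pg] gf]]; rewrite /v /=.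
  rewrite -lee_fin -measure_of_setT// fineK; last first.
    rewrite ge0_fin_numE//; apply: integral_ge0 => t _; by rewrite lee_fin.
  rewrite pg//; apply: ge0_le_integral => //; exact/measurable_EFinP.
have [|||||[[z g] /= [zg gf]] maxz] :=
    @maximal_value R P rel v (fine (\int[mu]_t (f t)%:E)%E) _ _ _ _ _ P0.
- by move=> p; split=> //; rewrite subrr; exact: pos0.
- move=> p q r [pq fpq] [qr fqr]; split=> [|t]; last exact: le_trans (fqr t).
  by rewrite -(subrK (sval q).1 (sval r).1) -addrA; exact: posD.
- by move=> p q [/(_ \top%O) + _]; rewrite (scalarB (mS _)) subr_ge0.
- exact: vle.
- move=> u urel.
  have [||z [zf pz zu zle]] := @density_limit (fun n => (sval (u n)).1)
    (fun n => (sval (u n)).2) (fine (\int[mu]_t (f t)%:E)%E)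
    (fun n => (svalP (u n)).1).
  + by move=> n t; case: (urel n).
  + by move=> n; exact: (vle (u n)).
  have zgf t : (limn (fun n => (sval (u n)).2 t) <= (f t)%:E)%E.
    apply: lime_le; last by apply: nearW => n; have [_] := svalP (u n); exact.
    apply: ereal_nondecreasing_is_cvgn; apply/nondecreasing_seqP => n.
    by case: (urel n).
  by exists (exist _ (z, _) (conj zf zgf)) => n; split=> /=.
have [pz mg g0 zE] := zg.
have gfin t : g t \is a fin_num.
  by rewrite ge0_fin_numE//; apply: le_lt_trans (gf t) _; rewrite ltry.
have mfg : measurable_fun setT (fine \o g) by exact: measurableT_comp.
pose B n := [set t | fine (g t) + n.+1%:R^-1 <= f t].
have mB n : measurable (B n).
  rewrite -[B n]setTI; apply: (measurable_fun_ler _ mf) => //.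
  exact: measurable_funD.
have B0 n : mu (B n) = 0%E.
  apply: mu_null => a Da.
  have n0 : 0 <= n.+1%:R^-1 :> R by rewrite invr_ge0.
  have [z1 [z1g z1E]] := density_piece Da (mB n) n0.
  have zz1 := densityD zg z1g.
  have gf1 t : (g t + (n.+1%:R^-1 * \1_(B n `&` cl a) t)%:E <= (f t)%:E)%E.
    rewrite indicE; have [|] := boolP (t \in _); last by rewrite mulr0 adde0.
    by rewrite inE mulr1 => -[Bt _]; rewrite -(fineK (gfin t)) -EFinD lee_fin.
  have := maxz (exist _ (z + z1, _) (conj zz1 gf1)) _.
  rewrite /v/= (scalarD (mS _)) gerDl => h.
  have pz1 : pos z1 by case: z1g.
  have : m \top%O z1 <= 0.
    apply: h; split=> [|t] /=; first by rewrite addrC addKr.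
    by rewrite leeDl//; case: z1g.
  rewrite -lee_fin -measure_of_setT// z1E// setIT => h1; apply/eqP.
  rewrite eq_le measure_ge0 andbT.
  move: h1; rewrite -[X in (_ <= X)%E -> _](mule0 n.+1%:R^-1%:E).
  by rewrite lee_pmul2l// lte_fin invr_gt0.
have aefg : ae_eq mu setT g (EFin \o f).
  have : {ae mu, forall t, forall n, ~ B n t}.
    apply: ae_foralln => n; exists (B n); split=> // t /= /contrapT.
    by [].
  apply: filterS => t nB _; apply/eqP; rewrite eq_le gf/= leNgt; apply/negP.
  rewrite -(fineK (gfin t)) lte_fin -subr_gt0 => d0.
  apply: (nB (Num.truncn (f t - fine (g t))^-1)); rewrite /B/=.
  rewrite addrC -lerBrDr -[leRHS]invrK lef_pV2 ?posrE ?invr_gt0//.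
  by apply: ltW; exact: truncnS_gt.
exists z; split=> //.
- exact/measurable_EFinP.
move=> C mC; rewrite zE//; apply: ge0_ae_eq_integral => //.
- exact: measurable_funS mg.
- by apply/measurable_EFinP; exact: measurable_funS mf.
- by move=> t _; rewrite lee_fin.
- by apply: filterS aefg => t /(_ I).
Qed.

(** Let a be a Hahn set of y - z.  The restriction w of z to a together with
    that of y to the complement is below both y and z; its measure vanishes on B
    and outside B, so w = 0.  Thus y lives on a and z on its complement, and the
    norm of y - z is attained at a with value m top y + m top z. *)
Lemma density_norm y z f g B : density y f -> density z g -> measurable B ->
  (forall t, B t -> f t = 0%E) -> (forall t, ~ B t -> g t = 0%E) ->
  `|y - z| = m \top%O y + m \top%O z.
Proof.
move=> [py mf f0 yf] [pz mg g0 zg] mB fB gB.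
have [a [apos aneg]] := hahn_component (y - z).
pose w := restriction a z + restriction (~` a)%O y.
have pw : pos w by apply: posD; exact: pos_restriction.
have wm b : m b w = m (a `&` b)%O z + m (~` a `&` b)%O y.
  by rewrite (scalarD (mS _)) !mass_restriction.
have yw : pos (y - w).
  move=> b; have := apos b; rewrite mass_restriction (scalarB (mS _)) (scalarB (mS _)) wm.
  by have := mass_split a b y; lra.
have zw : pos (z - w).
  move=> b; have := aneg b.
  rewrite (scalarN (mS _)) mass_restriction (scalarB (mS _)) (scalarB (mS _)) wm.
  by have := mass_split a b z; lra.
have mCB : measurable (~` B) by exact: measurableC.
have wB : measure_of w B = 0%E.
  apply/eqP; rewrite eq_le measure_ge0 andbT; apply: le_trans (measure_of_le pw yw mB) _.
  rewrite yf// integral0_eq// => t Bt; exact: fB.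
have wCB : measure_of w (~` B) = 0%E.
  apply/eqP; rewrite eq_le measure_ge0 andbT; apply: le_trans (measure_of_le pw zw mCB) _.
  rewrite zg// integral0_eq// => t Bt; exact: gB.
have w0 : w = 0.
  apply: pos_eq0 => //; rewrite -lee_fin -measure_of_setT// -(setUv B) measureU ?setICr//.
  by rewrite [Y in (Y + _)%E]wB [Y in (_ + Y)%E]wCB adde0.
have az : m a z = 0.
  by have := wm a; rewrite w0 (scalar0 (mS _)) meetxx meetCx mass_bot addr0.
have ay : m (~` a)%O y = 0.
  by have := wm (~` a)%O; rewrite w0 (scalar0 (mS _)) meetxx meetxC mass_bot add0r.
apply/eqP; rewrite eq_le; apply/andP; split.
  by rewrite -!pos_norm//; exact: ler_normB.
have := mass_le_norm H a (y - z); rewrite !(scalarB (mS _)) az ay.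
by move: ay; rewrite !mass_compl; lra.
Qed.

(** A density of a finite measure is finite almost everywhere. *)
Lemma density_real y : pos y ->
  exists h : T -> R, (forall t, 0 <= h t) /\ density y (EFin \o h).
Proof.
move=> py; have [f [_ mf f0 yf]] := density_exists py.
have h0 t : 0 <= fine (f t) by rewrite fine_ge0.
have mh : measurable_fun setT (fine \o f) by exact: measurableT_comp.
have intf : mu.-integrable setT f.
  apply/integrableP; split=> //.
  under eq_integral do rewrite gee0_abs//.
  by rewrite -yf// measure_of_setT// ltry.
have aef : ae_eq mu setT f (EFin \o (fine \o f)).
  apply: filterS (integrable_ae measurableT intf) => t /(_ I) ft _ /=.
  by rewrite fineK.
exists (fine \o f); split=> //; split=> //.
- exact/measurable_EFinP.
move=> B mB; rewrite yf//; apply: ge0_ae_eq_integral => //.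
- exact: measurable_funS mf.
- by apply/measurable_EFinP; exact: measurable_funS mh.
- by move=> t _; rewrite lee_fin h0.
- by apply: filterS aef => t /(_ I).
Qed.

(** The relation x ~ h, linear in the pair, whose graph is the isometry to be
    built. *)
Definition represents x (h : T -> R) : Prop :=
  mu.-integrable setT (EFin \o h) /\ forall a, m a x = \int[mu]_(t in cl a) h t.

Lemma density_represents y h : (forall t, 0 <= h t) ->
  density y (EFin \o h) -> represents y h.
Proof.
move=> h0 [py mh _ yh]; split.
  apply/integrableP; split=> //.
  under eq_integral do rewrite gee0_abs ?lee_fin//.
  by rewrite -yh// measure_of_setT// ltry.
move=> a; rewrite /Rintegral -[LHS]/(fine (m a y)%:E) -measure_of_cl// yh//.
exact: measurable_cl.
Qed.

Lemma integrable_cl h a : mu.-integrable setT (EFin \o h) ->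
  mu.-integrable (cl a) (EFin \o h).
Proof. by apply: integrableS => //; exact: measurable_cl. Qed.

Lemma represents_lin (s : R) x y h k : represents x h -> represents y k ->
  represents (s *: x + y) (fun t => s * h t + k t).
Proof.
move=> [ih xh] [ik yk].
have ish : mu.-integrable setT (EFin \o (fun t => s * h t)).
  by have := integrableZl measurableT s ih.
split; first by have := integrableD measurableT ish ik.
move=> a; rewrite mS xh yk RintegralD; [|exact: measurable_cl|exact: integrable_cl
  |exact: integrable_cl].
by rewrite RintegralZl//; [exact: measurable_cl|exact: integrable_cl].
Qed.

Lemma represents_exists x : exists h, represents x h.
Proof.
have [a [apos aneg]] := hahn_component x.
have [h [h0 ah]] := density_real apos.
have [k [k0 ak]] := density_real aneg.
(* The coefficient -1 puts the difference in the form of [represents_lin]. *)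
exists (fun t => -1 * k t + h t).
have -> : x = -1 *: - restriction (~` a)%O x + restriction a x.
  apply: mass_ext => b; rewrite scaleN1r opprK (scalarD (mS _)) !mass_restriction.
  by rewrite (mass_split a b x) addrC.
by apply: represents_lin; exact: density_represents.
Qed.

(** The element is the difference of those with densities the positive and the
    negative part of h, which live on complementary sets. *)
Lemma represents_fun h : mu.-integrable setT (EFin \o h) ->
  exists x, represents x h /\ (\int[mu]_t `|h t|%:E = `|x|%:E)%E.
Proof.
move=> ih; have mh : measurable_fun setT h.
  by apply/measurable_EFinP; case/integrableP: ih.
pose hp t := Num.max (h t) 0; pose hn t := Num.max (- h t) 0.
have mhp : measurable_fun setT hp by exact: measurable_maxr.
have mhn : measurable_fun setT hn.
  by apply: measurable_maxr => //; exact: measurableT_comp.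
have hp0 t : 0 <= hp t by rewrite /hp le_max lexx orbT.
have hn0 t : 0 <= hn t by rewrite /hn le_max lexx orbT.
have habs t : `|h t| = hp t + hn t.
  rewrite /hp /hn; have [h0|h0] := leP 0 (h t).
    by rewrite ger0_norm// max_r ?addr0// oppr_le0.
  by rewrite ltr0_norm// max_l ?add0r// oppr_ge0 ltW.
have hE t : h t = -1 * hn t + hp t.
  rewrite /hp /hn; have [h0|h0] := leP 0 (h t).
    by rewrite max_r ?oppr_le0// mulr0 add0r.
  by rewrite max_l ?oppr_ge0 ?ltW// mulN1r opprK addr0.
have fin_int : (\int[mu]_t `|h t|%:E < +oo)%E by case/integrableP: ih.
have split_int : (\int[mu]_t `|h t|%:E =
    \int[mu]_t (hp t)%:E + \int[mu]_t (hn t)%:E)%E.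
  under eq_integral do rewrite habs EFinD.
  rewrite ge0_integralD//.
  - by move=> t _; rewrite lee_fin.
  - exact/measurable_EFinP.
  - by move=> t _; rewrite lee_fin.
  - exact/measurable_EFinP.
have ip : (\int[mu]_t (hp t)%:E < +oo)%E.
  apply: le_lt_trans fin_int; rewrite split_int leeDl//.
  by apply: integral_ge0 => t _; rewrite lee_fin.
have in_ : (\int[mu]_t (hn t)%:E < +oo)%E.
  apply: le_lt_trans fin_int; rewrite split_int leeDr//.
  by apply: integral_ge0 => t _; rewrite lee_fin.
have [y yd] := density_of_fun mhp hp0 ip.
have [z zd] := density_of_fun mhn hn0 in_.
have [py _ _ yE] := yd; have [pz _ _ zE] := zd.
exists (-1 *: z + y); split.
  have -> : h = (fun t => -1 * hn t + hp t) by exact/funext.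
  by apply: represents_lin; exact: density_represents.
rewrite scaleN1r addrC (density_norm (B := [set t | h t <= 0]) yd zd).
- by rewrite split_int EFinD -!measure_of_setT// yE// zE.
- rewrite -[X in measurable X]setTI; exact: (measurable_fun_ler mh).
- by move=> t /= h0; rewrite /hp max_r.
- move=> t /= /negP; rewrite -ltNge => h0; rewrite /hn max_r//.
  by rewrite oppr_le0 ltW.
Qed.

Lemma represents_uniq x y h : represents x h -> represents y h -> x = y.
Proof. by move=> [_ xh] [_ yh]; apply: mass_ext => a; rewrite xh yh. Qed.

Lemma represents_norm x h : represents x h -> (\int[mu]_t `|h t|%:E = `|x|%:E)%E.
Proof.
move=> xh; have [y [yh yn]] := represents_fun xh.1.
by rewrite (represents_uniq xh yh).
Qed.

(** The function - k + h represents 0, so its L_1 norm is 0. *)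
Lemma represents_ae x h k : represents x h -> represents x k ->
  {ae mu, forall t, h t = k t}.
Proof.
move=> xh xk; have xhk := represents_lin (-1) xk xh.
have [ihk _] := xhk; have [mhk _] := integrableP _ _ _ ihk.
have := represents_norm xhk; rewrite scaleN1r addNr normr0 => h0.
have /(ae_eq_integral_abs _ measurableT mhk) : (\int[mu]_t 
    `|(EFin \o (fun t => -1 * k t + h t)%R) t| = 0)%E.
  exact: h0.
apply: filterS => t /(_ I) [] /eqP.
by rewrite mulN1r addrC subr_eq0 => /eqP.
Qed.

Lemma represents_ae_eq x h k : represents x h -> mu.-integrable setT (EFin \o k) ->
  {ae mu, forall t, k t = h t} -> represents x k.
Proof.
move=> [ih xh] ik kh; split=> // a; rewrite xh /Rintegral; congr fine.
apply: ae_eq_integral => //; first exact: measurable_cl.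
- by have /integrableP[] := integrable_cl a ih.
- by have /integrableP[] := integrable_cl a ik.
- by apply: filterS kh => t ->.
Qed.

(** Every element has a class, every class has an element, and each determines
    the other, so choosing representatives gives a bijection. *)
Lemma masses_isometric_to_L1 : isometric_to_L1 Z mu.
Proof.
have /choice[J JP] x : exists q : LspaceType1 mu, represents x q.
  have [h xh] := represents_exists x; have [q qh] := L1_class xh.1.
  by exists q; apply: represents_ae_eq xh _ qh; exact: L1_integrable.
have /choice[K KP] (q : LspaceType1 mu) : exists x, represents x q.
  by have [x [xq _]] := represents_fun (L1_integrable q); exists x.
exists J; split.
- exists K => [x|q]; first exact: represents_uniq (KP (J x)) (JP x).
  by apply: L1_ext; exact: represents_ae (JP (K q)) (KP q).
- move=> s x y; apply: represents_ae (JP _) _.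
  exact: represents_lin.
- by move=> x; exact: represents_norm (JP x).
Qed.
End Measures.

Theorem boolean_masses_L1 : exists (dT : measure_display) (T : measurableType dT)
    (mu : {measure set T -> \bar R}), direct_sum_property mu /\ isometric_to_L1 Z mu.
Proof.
have [dT [T [cl [clT clI clC clM clE]]]] := stone_representation R (mass_nontrivial H).
have [D [X [DX Ddisj Dmax]]] := maximal_supports.
exists dT, T, (esum_measure D (fun a => measure_of clE (X a))); split.
  exact: (direct_sum_property_mu clT clI clC clM clE DX Ddisj).
exact: (masses_isometric_to_L1 clT clI clC clM clE DX Ddisj Dmax).
Qed.
End Masses.

(** * The representation theorem *)

Theorem theorem3p2 (R : realType) (Z : completeNormedModType R) (e : Z -> R) :
  strongly_facially_symmetric Z ->
  neutral_space Z ->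
  geometric_tripotent e ->
  (unit_ball : set Z) = convex_hull (exposed e `|` exposed (\- e)) ->
  nabla_boolean_algebra e ->
  exists (d : measure_display) (T : measurableType d)
         (mu : {measure set T -> \bar R}),
    direct_sum_property mu /\ isometric_to_L1 Z mu.
Proof.
move=> sfs _ te hull [d [L [phi [bij ple pcompl]]]].
exact: (boolean_masses_L1 (boolean_masses_phi sfs te hull bij ple pcompl)).
Qed.
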